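(* Let $0<\tau'\le\tau$ satisfy $$\max\left\{\frac{1}{\tau\gamma/L_A^2+1},\frac{1}{\delta/\tau'+1}\right\}\le\frac{\tau'}{\tau}\le1,$$ let $(x_n,z_n,y_n)_n$ be generated by the accelerated ADMM described in the context, and let $\omega$ satisfy $$\max\left\{\frac{\tau'/\tau+1}{\tau\gamma/L_A^2+2},\frac{1}{\delta/\tau'+1}\right\}\le\omega\le\frac{\tau'}{\tau}.$$ For $N\ge1$ let $T_N=\sum_{n=1}^N\omega^{-(n-1)}=\frac{1-\omega^N}{\omega^{N-1}(1-\omega)}$, $X_N=\frac{1}{T_N}\sum_{n=1}^N\omega^{-(n-1)}x_n$, $Y_N=\frac{1}{T_N}\sum_{n=1}^N\omega^{-(n-1)}y_n$. Then: (i) for all $N\ge1$ and all $(x,y)\in X\times Y$, $$0\le\frac{1-\omega}{\omega(1-\omega^N)}\Big(1-\frac{\omega\tau}{\tau'}\Big)\frac{1}{2\tau}\|Ax-Ax_N\|^2+\frac{1-\omega}{\omega(1-\omega^N)}\frac{\tau'}{2}\|y-y_N\|^2+\ell(X_N;y)-\ell(x;Y_N)\le\frac{1}{T_N}\frac{1}{2\tau}\|Ax-Ax_0\|^2+\frac{1}{T_N}\frac{\tau'}{2}\|y-y_0\|^2;$$ (ii) the objective error converges linearly in the ergodic sense and the dual iterates converge linearly, with rate $\omega$: there is a constant $C$ independent of $N$ such that $0\le f(X_N)-f(x^* )\le C\omega^N$ and $\|y_N-y^*\|^2\le C\omega^N$ for all $N\ge1$; if moreover $1-\omega\tau/\tau'\ne0$,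 then the primal iterates $z_N$ also converge linearly, $\|z_N-z^*\|^2\le C\omega^N$ with $z^*=Ax^*$, for some constant $C$. (iii) The best (smallest) rate $\omega$ allowed by the two displayed conditions above is $$\omega^*=\frac{\sqrt{1+4L_A^2/(\gamma\delta)}-1}{\sqrt{1+4L_A^2/(\gamma\delta)}+1},$$ achieved for $$\tau=\frac{\delta}{2}\left(1+\sqrt{1+\frac{4L_A^2}{\gamma\delta}}\right),\qquad \frac{1}{\tau'}=\frac{\gamma}{2L_A^2}\left(1+\sqrt{1+\frac{4L_A^2}{\gamma\delta}}\right),$$ for which $\tau'/\tau=\omega^*$.
   Context: $X,Y$ are finite-dimensional real Hilbert spaces, $A:X\to Y$ is linear with norm $L_A=\|A\|$. $g:X\to\mathbb{R}\cup\{+\infty\}$ and $h:Y\to\mathbb{R}\cup\{+\infty\}$ are proper, convex, lower semicontinuous; $g$ is $\gamma$-strongly convex and the convex conjugate $h^*$ is $\delta$-strongly convex, $\gamma,\delta>0$ (so $h$ is differentiable with $1/\delta$-Lipschitz gradient). The problem is $\min_{x\in X}\{f(x):=g(x)+h(Ax)\}$, assumed to have a solution $x^*$, with $y^*=\nabla h(Ax^* )$, so that, writing $g_A(\xi):=\inf_{x\in X,\,Ax=\xi}g(x)$, the pair $(Ax^*,y^* )$ is a saddle point of $(\xi,y)\mapsto g_A(\xi)+\langle\xi,y\rangle-h^*(y)$. Put $\ell(x;y):=g(x)+\langle Ax,y\rangle-h^*(y)$, so that $f(x)=\sup_{y\in Y}\ell(x;y)$. Accelerated ADMM, from initial points $x_0\in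 X$, $z_0\in Y$, $y_0\in Y$: for $n\ge0$, $$x_{n+1}=\arg\min_{x\in X}\Big\{g(x)+\langle Ax,y_n\rangle+\tfrac{1}{2\tau}\|Ax-z_n\|^2\Big\},$$ $$z_{n+1}=\arg\min_{z\in Y}\Big\{h(z)-\langle z,y_n\rangle+\tfrac{1}{2\tau'}\|Ax_{n+1}-z\|^2\Big\},$$ $$y_{n+1}=y_n+\tfrac{1}{\tau'}(Ax_{n+1}-z_{n+1}).$$
   Formalization: In (i), 0 ≤ is claimed only for (x,y) with ℓ(x;Y_N) ≤ ℓ(X_N;y), incl. (x*,y* ), as it fails for general (x,y); the upper bound is proved as written if z_0 = Ax_0, and otherwise with z_0 in place of Ax_0; at ω = 1 the weight (1-ω)/(ω(1-ω^N)) means its limit 1/N. *)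

(* Defs.v *)
From HB Require Import structures.
From mathcomp Require Export all_boot all_order all_algebra sesquilinear.
From mathcomp Require Export all_classical all_reals all_analysis.

Set Implicit Arguments.
Unset Strict Implicit.
Unset Printing Implicit Defensive.

Import Order.TTheory GRing.Theory Num.Theory.
Import numFieldNormedType.Exports.

Local Open Scope classical_set_scope.
Local Open Scope ring_scope.

(* Finite-dimensional real Hilbert spaces: finite-dimensional normed modules
   whose norm comes from an inner product (completeness is then automatic). *)
HB.mixin Record NormedVector_isHilbert (R : realType) (V : Type)
    of NormedModule R V & Vector R V := {
  inner : {dot V for (@idfun R)};
  normr_inner : forall x : V, `|x| ^+ 2 = inner x x
}.

#[short(type="finHilbertType")]
HB.structure Definition FinHilbert (R : realType) :=
  {V of NormedModule R V & Vector R V & NormedVector_isHilbert R V}.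

Notation "''[' u , v ]" := (inner u%R v%R) : ring_scope.

Definition opnorm (R : realType) (X Y : finHilbertType R)
    (A : {linear X -> Y}) : R :=
  sup [set `|A x| | x in [set x : X | `|x| <= 1]].

Section ConvexAnalysis.
Context {R : realType} {X : finHilbertType R}.
Implicit Types (f : X -> \bar R) (x y : X).
Local Open Scope ereal_scope.

Definition proper f := (forall x, f x != -oo) /\ (exists x, f x < +oo).

Definition strongly_convex (m : R) f := forall x y (t : R), (0 <= t <= 1)%R ->
  f (t *: x + (1 - t) *: y)%R + (m / 2 * t * (1 - t) * `|x - y| ^+ 2)%:E
    <= t%:E * f x + (1 - t)%:E * f y.

Definition convex f := strongly_convex 0 f.

Definition conjugate f y : \bar R :=
  ereal_sup [set '[x, y]%R%:E - f x | x in [set: X]].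

Definition is_argmin f x := forall x', f x <= f x'.

(* p is the gradient at x of f, finite near x and differentiable at x. *)
Definition is_gradient f x p :=
  [/\ \forall u \near x, f u \is a fin_num,
      differentiable (fine \o f : X -> R^o) x &
      forall v, 'd (fine \o f : X -> R^o) x v = '[p, v]%R].

End ConvexAnalysis.

Section Problem.
Context {R : realType} {X Y : finHilbertType R}.
Variables (A : {linear X -> Y}) (g : X -> \bar R) (h : Y -> \bar R).
Local Open Scope ereal_scope.

Definition objective (x : X) : \bar R := g x + h (A x).

Definition lagrangian (x : X) (y : Y) : \bar R :=
  g x + '[A x, y]%R%:E - conjugate h y.

Definition admm (tau tau' : R) (x : nat -> X) (z y : nat -> Y) : Prop :=
  forall n,
    [/\ is_argmin (fun u : X => g u + '[A u, y n]%R%:E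
          + (1 / (2 * tau) * `|A u - z n| ^+ 2)%:E) (x n.+1),
        is_argmin (fun w : Y => h w - '[w, y n]%R%:E
          + (1 / (2 * tau') * `|A (x n.+1) - w| ^+ 2)%:E) (z n.+1) &
        y n.+1 = (y n + (1 / tau') *: (A (x n.+1) - z n.+1))%R].

End Problem.

Section Conditions.
Context {R : realType}.
Variables (L gamma delta : R).

Definition step_condition (tau tau' : R) : Prop :=
  Num.max (1 / (tau * gamma / L ^+ 2 + 1)) (1 / (delta / tau' + 1))
    <= tau' / tau <= 1.

Definition rate_condition (tau tau' omega : R) : Prop :=
  Num.max ((tau' / tau + 1) / (tau * gamma / L ^+ 2 + 2))
          (1 / (delta / tau' + 1))
    <= omega <= tau' / tau.

End Conditions.

Section Ergodic.
Context {R : realType}.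
Variable omega : R.

Definition ergodic_weight (N : nat) : R :=
  \sum_(1 <= n < N.+1) omega ^- n.-1.

Definition ergodic_mean (V : lmodType R) (u : nat -> V) (N : nat) : V :=
  (1 / ergodic_weight N) *: \sum_(1 <= n < N.+1) omega ^- n.-1 *: u n.

(* (1 - omega) / (omega (1 - omega^N)), extended by its limit 1 / N at
   omega = 1, a value allowed by rate_condition when tau' = tau. *)
Definition last_weight (N : nat) : R :=
  if omega == 1 then 1 / N%:R
  else (1 - omega) / (omega * (1 - omega ^+ N)).

End Ergodic.

(* Main.v *)
(** Put [xi_n = z_n + tau' d_n] with [d_n = y_n - y_{n-1}], [d_0 = 0]; then
    [xi_n = A x_n] for [n >= 1] and [xi_0 = z_0], and the x-step is a primal-dual
    step with extrapolation parameter [tau' / tau].  The optimality conditions of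
    the two minimisations, sharpened by strong convexity, show that the energy
      E_n = |A u - xi_n|^2 / (2 tau) + tau' |v - y_n|^2 / 2
            + omega tau' |d_n|^2 / 2 + omega <d_n, A u - xi_n>
    satisfies [l(x_{n+1}; v) - l(u; y_{n+1}) <= E_n - E_{n+1} / omega].  Weighting by
    [omega^-n] and summing, Jensen's inequality gives (i).

    For the objective error, [h] is bounded above by its quadratic model of
    curvature [1 / delta] at [A xstar]: at proximal points this is the strong
    monotonicity of the subdifferential of the conjugate, and it passes to all
    points by lower semicontinuity, which also shows that [h] is finite everywhere.
    Strong convexity of [g] then bounds [f(X_N) - f(xstar)] by
    [(1 + L^2 / (gamma delta)) (l(X_N; ystar) - l(xstar; Y_N))]. *)
From mathcomp Require Import lra ring.
Require Import Defs.
Import Order.TTheory GRing.Theory Num.Theory.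
Import numFieldNormedType.Exports.
Local Open Scope classical_set_scope.
Local Open Scope ring_scope.
Local Open Scope ereal_scope.

Set Implicit Arguments.
Unset Strict Implicit.

(** * Finite-dimensional Hilbert spaces *)

Section InnerProduct.
Context {R : realType} {V : finHilbertType R}.
Implicit Types u v w : V.
Local Open Scope ring_scope.

Lemma innerC u v : '[u, v] = '[v, u].
Proof. by rewrite (hermC (inner : {dot V for _})) expr0 mul1r. Qed.

Lemma innerDl u v w : '[u + v, w] = '[u, w] + '[v, w].
Proof. exact: linearDl. Qed.

Lemma innerDr u v w : '[w, u + v] = '[w, u] + '[w, v].
Proof. exact: linearDr. Qed.

Lemma innerNl u v : '[- u, v] = - '[u, v].
Proof. exact: linearNl. Qed.

Lemma innerNr u v : '[u, - v] = - '[u, v].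
Proof. exact: linearNr. Qed.

Lemma innerZl (a : R) u v : '[a *: u, v] = a * '[u, v].
Proof. exact: linearZl_LR. Qed.

Lemma innerZr (a : R) u v : '[u, a *: v] = a * '[u, v].
Proof. exact: linearZr_LR. Qed.

Lemma inner0l v : '[0, v] = 0.
Proof. exact: linear0l. Qed.

Lemma inner0r v : '[v, 0] = 0.
Proof. exact: linear0r. Qed.

Definition innerE :=
  (innerDl, innerDr, innerNl, innerNr, innerZl, innerZr, inner0l, inner0r).

Lemma inner_ge0 u : 0 <= '[u, u].
Proof. by rewrite -normr_inner sqr_ge0. Qed.

(** Cauchy-Schwarz: for unit vectors it is the expansion of [|a - b|^2 >= 0], and the general case
    follows by scaling. *)
Lemma inner_le_norm u v : '[u, v] <= `|u| * `|v|.
Proof.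
have H (a b : V) : `|a| = 1 -> `|b| = 1 -> '[a, b] <= 1.
  move=> ha hb; have := inner_ge0 (a - b); rewrite !innerE -!normr_inner ha hb.
  rewrite (innerC b a); lra.
have [->|u0] := eqVneq u 0; first by rewrite inner0l normr0 mul0r.
have [->|v0] := eqVneq v 0; first by rewrite inner0r normr0 mulr0.
have nu : 0 < `|u| by rewrite normr_gt0.
have nv : 0 < `|v| by rewrite normr_gt0.
have := H (`|u|^-1 *: u) (`|v|^-1 *: v).
rewrite !normrZ !normfV !normr_id !mulVf ?gt_eqF// => /(_ erefl erefl).
by rewrite !innerE mulrA -invfM mulrC ler_pdivrMr ?mulr_gt0// mul1r mulrC.
Qed.

(** The right side exceeds the left by exactly [|u - v|^2 + |u + w|^2 + |v + w|^2]. *)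
Lemma norm3_sqr_le u v w :
  `|u + v - w| ^+ 2 <= 3 * (`|u| ^+ 2 + `|v| ^+ 2 + `|w| ^+ 2).
Proof.
have := inner_ge0 (u - v); have := inner_ge0 (u + w); have := inner_ge0 (v + w).
rewrite !normr_inner !innerE (innerC v u) (innerC w u) (innerC w v); lra.
Qed.

End InnerProduct.

(** * Coordinates in a basis, compactness of balls, boundedness of linear maps *)

Section FiniteDimension.
Context {R : realType} {V : finHilbertType R}.
Local Open Scope ring_scope.
Local Notation n := (\dim {:V}).

Definition of_coords (a : 'rV[R]_n) : V := \sum_i a ord0 i *: (vbasis {:V})`_i.

Definition coords (v : V) : 'rV[R]_n := \row_i coord (vbasis {:V}) i v.

Lemma coordsK v : of_coords (coords v) = v.
Proof.
rewrite {2}(coord_vbasis (memvf v)); apply: eq_bigr => i _.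
by rewrite mxE.
Qed.

Lemma of_coords_eq0 a : of_coords a = 0 -> a = 0.
Proof.
move=> h; have fr := basis_free (vbasisP {:V}).
by apply/rowP => i; rewrite (freeP fr (a ord0) h) mxE.
Qed.

Lemma of_coordsZ k a : of_coords (k *: a) = k *: of_coords a.
Proof.
by rewrite /of_coords scaler_sumr; apply: eq_bigr => i _; rewrite mxE scalerA.
Qed.

Lemma continuous_of_coords : continuous of_coords.
Proof.
apply: continuous_big => [|i _ a]; first exact: add_continuous.
have ca : (a : 'rV_n) ord0 i @[a --> a] --> a ord0 i by exact: coord_continuous.
exact: (@cvgZr_tmp _ _ _ (nbhs a) _ _ _ _ ca).
Qed.

(** Equivalence of norms: [|of_coords a|] attains its minimum on the compact unit sphere of row
    vectors, this minimum is positive because the basis is free, and its inverse serves as [c] by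
    homogeneity. *)
Lemma coords_bounded : exists2 c : R, 0 < c & forall v, `|coords v| <= c * `|v|.
Proof.
have cN : continuous (fun a => `|of_coords a|).
  move=> a; apply: continuous_comp; first exact: continuous_of_coords.
  exact: norm_continuous.
pose S := [set a : 'rV[R]_n | `|a| = 1].
have cS : compact S.
  apply: bounded_closed_compact.
    by exists 1; split => [|M M1 a /= ->]; [exact: num_real|exact: ltW].
  rewrite (_ : S = (fun a : 'rV[R]_n => `|a|) @^-1` [set 1])//.
  by have /continuous_closedP := @norm_continuous R 'rV[R]_n; apply; exact: closed_eq.
have [[a0 Sa0]|S0] := pselect (exists a, S a); last first.
  (* With an empty unit sphere every coordinate vector is zero, since a nonzero one could be
     normalised. *)
  exists 1 => // v; have [->|a0] := eqVneq (coords v) 0.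
    by rewrite normr0 mul1r.
  exfalso; apply: S0; exists (`|coords v|^-1 *: coords v).
  by rewrite /S/= normrZ normfV normr_id mulVf ?normr_eq0.
have [|b Sb hb] := EVT_min_rV _ cS (continuous_subspaceT cN).
  by exists a0.
have b0 : 0 < `|of_coords b|.
  rewrite normr_gt0; apply/eqP => /of_coords_eq0 b0.
  by move: Sb; rewrite inE /S/= b0 normr0 => /esym/eqP; rewrite oner_eq0.
exists `|of_coords b|^-1; first by rewrite invr_gt0.
move=> v; rewrite mulrC ler_pdivlMr//.
have [->|a1] := eqVneq (coords v) 0; first by rewrite normr0 mul0r.
have na : 0 < `|coords v| by rewrite normr_gt0.
have /hb : `|coords v|^-1 *: coords v \in S.
  by rewrite inE /S/= normrZ normfV normr_id mulVf ?normr_eq0.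
by rewrite of_coordsZ coordsK normrZ normfV normr_id mulrC ler_pdivlMr// mulrC.
Qed.

(** [K] is the continuous image of a ball of row vectors of radius [c * r]. A compact set containing
    the ball is enough for the covering argument that yields minimisers. *)
Lemma finHilbert_closed_ball_compact (r : R) :
  exists2 K : set V, compact K & forall v, `|v| <= r -> K v.
Proof.
have [c c0 hc] := coords_bounded.
exists (of_coords @` [set a : 'rV[R]_n | `|a| <= c * r]).
  apply: continuous_compact; first exact/continuous_subspaceT/continuous_of_coords.
  apply: bounded_closed_compact.
    exists (c * r); split => [|M M1 a /= ha]; first exact: num_real.
    by rewrite (le_trans ha)// ltW.
  rewrite (_ : mkset _ = (fun a : 'rV[R]_n => `|a|) @^-1` [set x | x <= c * r])//.
  by have /continuous_closedP := @norm_continuous R 'rV[R]_n; apply; exact: closed_le.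
move=> v vr; exists (coords v); last exact: coordsK.
by rewrite /= (le_trans (hc v))// ler_wpM2l// ltW.
Qed.

Lemma finHilbert_linear_bounded (W : normedModType R) (A : {linear V -> W}) :
  exists2 M : R, 0 <= M & forall v, `|A v| <= M * `|v|.
Proof.
have [c c0 hc] := coords_bounded.
exists ((\sum_(i < n) `|A (vbasis {:V})`_i|) * c).
  by rewrite mulr_ge0 ?sumr_ge0// ltW.
move=> v; rewrite -{1}(coordsK v) linear_sum (le_trans (ler_norm_sum _ _ _))//.
rewrite -mulrA mulr_suml; apply: ler_sum => i _.
rewrite linearZ normrZ mulrC ler_wpM2l//.
apply: le_trans (hc v).
rewrite [leRHS]/Num.norm/= mx_normrE.
by apply/bigmax_geP; right; exists (ord0, i).
Qed.

End FiniteDimension.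

Section OperatorNorm.
Context {R : realType} {X Y : finHilbertType R}.
Variable A : {linear X -> Y}.
Local Open Scope ring_scope.

Let S := [set `|A x| | x in [set x : X | `|x| <= 1]].

Let S_ub : has_sup S.
Proof.
have [M M0 hM] := finHilbert_linear_bounded A.
split; first by exists `|A 0|, 0 => //=; rewrite normr0.
exists M => _ [x /= x1 <-]; rewrite (le_trans (hM x))//.
by rewrite -[leRHS]mulr1 ler_wpM2l.
Qed.

Lemma opnorm_ge0 : 0 <= opnorm A.
Proof.
apply: (ub_le_sup S_ub.2); exists 0; rewrite /= ?normr0//.
by rewrite linear0 normr0.
Qed.

Lemma le_opnorm x : `|A x| <= opnorm A * `|x|.
Proof.
have [->|x0] := eqVneq x 0; first by rewrite linear0 !normr0 mulr0.
rewrite -ler_pdivrMr ?normr_gt0//.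
apply: (ub_le_sup S_ub.2); exists (`|x|^-1 *: x).
  by rewrite /= normrZ normfV normr_id mulVf ?normr_eq0.
by rewrite linearZ normrZ normfV normr_id mulrC.
Qed.

(* When [A = 0] the junk value [gamma / 0 = 0] makes the bound trivial. *)
Lemma opnorm_sqr_le (gamma : R) x : 0 < gamma ->
  gamma / opnorm A ^+ 2 * `|A x| ^+ 2 <= gamma * `|x| ^+ 2.
Proof.
move=> g0; have [L0|L0] := eqVneq (opnorm A) 0.
  by rewrite L0 expr0n/= invr0 mulr0 mul0r mulr_ge0 ?sqr_ge0// ltW.
have Lp : 0 < opnorm A ^+ 2 by rewrite exprn_gt0// lt_def L0 opnorm_ge0.
rewrite -mulrA ler_pM2l// mulrC ler_pdivrMr// mulrC -exprMn.
by rewrite lerXn2r ?nnegrE ?mulr_ge0 ?opnorm_ge0// le_opnorm.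
Qed.

End OperatorNorm.

(** * Convex analysis *)

Section StronglyConvex.
Context {R : realType} {V : finHilbertType R}.
Implicit Types (f : V -> \bar R) (m : R).
Local Open Scope ring_scope.

Lemma strongly_convex_fine f m x y (t : R) :
  (forall u, f u != -oo%E) -> strongly_convex m f -> 0 <= t <= 1 ->
  f x \is a fin_num -> f y \is a fin_num ->
  f (t *: x + (1 - t) *: y) \is a fin_num /\
  fine (f (t *: x + (1 - t) *: y)) + m / 2 * t * (1 - t) * `|x - y| ^+ 2
    <= t * fine (f x) + (1 - t) * fine (f y).
Proof.
move=> fN fm t01 fx fy; have := fm x y t t01; have := fN (t *: x + (1 - t) *: y).
rewrite -(fineK fx) -(fineK fy) -!EFinM -EFinD.
by case: (f (_ + _)) => // r _; rewrite -EFinD lee_fin.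
Qed.

(** Replaces letting [t] tend to 0 after division by [t]: if [a < 0], the choice
    [t = - a / (- a + |b|)] gives [a + t |b| = - a^2 / (- a + |b|) < 0], a contradiction. *)
Lemma slope_ge0 (a b : R) :
  (forall t, 0 < t <= 1 -> 0 <= t * a + t ^+ 2 * b) -> 0 <= a.
Proof.
move=> H; rewrite leNgt; apply/negP => a0.
have b0 : 0 <= `|b| by [].
have d0 : 0 < - a + `|b| by lra.
pose t := - a / (- a + `|b|).
have t0 : 0 < t by rewrite divr_gt0// oppr_gt0.
have := H t; rewrite t0/= ler_pdivrMr// mul1r lerDl => /(_ b0).
have -> : t * a + t ^+ 2 * b = t * (a + t * b) by ring.
rewrite pmulr_rge0// => H1.
have : 0 <= a + t * `|b|.
  by rewrite (le_trans H1)// lerD2l ler_wpM2l ?ler_norm// ltW.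
have -> : a + t * `|b| = - (a ^+ 2 / (- a + `|b|)).
  by rewrite /t; field; rewrite gt_eqF.
by rewrite oppr_ge0 leNgt divr_gt0// exprn_even_gt0//= lt_eqF.
Qed.

(* The first-order condition of the regularised minimisation, with the
   quadratic gain due to strong convexity of [f]. *)
Lemma argmin_strongly_convex (W : finHilbertType R) f m (B : {linear V -> W})
    (q z : W) (c : R) x :
  proper f -> strongly_convex m f ->
  is_argmin (fun u => f u + '[B u, q]%:E + (c * `|B u - z| ^+ 2)%:E)%E x ->
  f x \is a fin_num /\
  forall u, f u \is a fin_num ->
    fine (f x) + '[B x - B u, q + (2 * c) *: (B x - z)]
      + m / 2 * `|u - x| ^+ 2 <= fine (f u).
Proof.
move=> [fN [x0 fx0]] fm xmin.
have fx : f x \is a fin_num.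
  have := xmin x0; have := fN x; have := fN x0; move: fx0.
  by case: (f x0) => // r _ _; case: (f x).
split=> // u fu.
rewrite -subr_ge0.
(* Minimality is tested at [x + t (u - x)]. The claimed gap is the coefficient of [t]; the strong
   convexity term and the quadratic penalty supply that of [t^2]. *)
apply: (@slope_ge0 _ (m / 2 * `|u - x| ^+ 2 + c * `|B u - B x| ^+ 2)) => t.
move=> /andP[t0 t1].
have t01 : 0 <= t <= 1 by rewrite ltW.
have [fut hut] := strongly_convex_fine fN fm t01 fu fx.
have := xmin (t *: u + (1 - t) *: x).
rewrite -(fineK fx) -(fineK fut) -!EFinD lee_fin.
have -> : B (t *: u + (1 - t) *: x) = B x + t *: (B u - B x).
  rewrite linearD !linearZ/= scalerBl scale1r scalerBr addrCA; congr (_ + _).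
have -> : B x + t *: (B u - B x) - z = (B x - z) + t *: (B u - B x).
  by rewrite addrAC.
move: hut; move: (fine (f (t *: u + (1 - t) *: x))) => F.
rewrite -(opprB (B u) (B x)); set a := B u - B x; set b := B x - z.
move: (`|u - x| ^+ 2) => d; clearbody a b.
rewrite /= !innerE !normr_inner !innerE (innerC a b).
move: (fine (f x)) (fine (f u)) => fx' fu' H1 H2.
rewrite (_ : _ + _ = t * (fu' - (fx' + (- '[a, q] - 2 * c * '[b, a])))
  + t ^+ 2 * (c * '[a, a]) - m / 2 * t * (1 - t) * d); last by ring.
lra.
Qed.

End StronglyConvex.

Section Conjugate.
Context {R : realType} {V : finHilbertType R}.
Implicit Types (f : V -> \bar R) (x y : V).
Local Open Scope ereal_scope.

Lemma conjugate_ge f x y : '[x, y]%:E - f x <= conjugate f y.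
Proof. by apply: ereal_sup_ubound; exists x. Qed.

Lemma conjugate_gtNy f y : proper f -> conjugate f y != -oo.
Proof.
move=> [fN [x fx]]; have := conjugate_ge f x y; have := fN x; move: fx.
by case: (f x) => // r _ _; rewrite -EFinB; case: (conjugate f y).
Qed.

(** Equality case of Fenchel-Young: a subgradient [y] at [x] makes [x] attain the supremum that
    defines the conjugate. *)
Lemma conjugate_subgradient f x y : proper f -> f x \is a fin_num ->
  (forall u, f u \is a fin_num ->
     (fine (f x) + '[y, u - x] <= fine (f u))%R) ->
  conjugate f y = ('[x, y] - fine (f x))%:E.
Proof.
move=> [fN _] fx sub; apply/eqP; rewrite eq_le; apply/andP; split; last first.
  by rewrite EFinB fineK// conjugate_ge.
apply: ge_ereal_sup => _ [u _ <-].
have [fu|] := boolP (f u \is a fin_num).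
  rewrite -(fineK fu) -EFinB lee_fin.
  by have := sub u fu; rewrite !innerE (innerC y u) (innerC y x); lra.
by have := fN u; case: (f u) => // _ _; exact: leNye.
Qed.

End Conjugate.

(** * First-order conditions from one-sided slopes *)

Section Gradient.
Context {R : realType} {V : finHilbertType R}.
Implicit Types (f : V -> \bar R) (x p : V).
Local Open Scope ring_scope.

(** A single step [t] with relative error [e] is all that the convexity arguments below need: they
    divide by [t] and use that [e] is arbitrary. *)
Lemma gradient_slope f x p w (e : R) : is_gradient f x p -> 0 < e ->
  exists t : R, [/\ 0 < t <= 1, f (x + t *: w) \is a fin_num &
    `|fine (f (x + t *: w)) - fine (f x) - t * '[p, w]| <= e * t].
Proof.
move=> [ffin df dfE] e0.
pose F : V -> R^o := fine \o f.
have dF : h^-1 *: ((F \o shift x) (h *: w) - F x) @[h --> (0:R)^'] --> ('[p, w] : R^o).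
  by rewrite -dfE -deriveE//; exact: diff_derivable.
have /cvgrPdist_le/(_ _ e0) D := dF.
have Nf : \forall h \near (0:R), f (h *: w + x) \is a fin_num.
  have hc : h *: w + x @[h --> (0:R)] --> x.
    rewrite -[X in _ --> X]add0r -(scale0r w).
    by apply: cvgD; [apply: cvgZr_tmp; exact: cvg_id|exact: cvg_cst].
  exact: hc ffin.
have [r /= r0 hr] : nbhs (0 : R) [set h : R | h != 0 ->
    `|'[p, w] - h^-1 *: ((F \o shift x) (h *: w) - F x)| <= e /\
    f (h *: w + x) \is a fin_num].
  have {}D : \forall h \near (0:R), h != 0 ->
    `|'[p, w] - h^-1 *: ((F \o shift x) (h *: w) - F x)| <= e := D.
  by apply: filterS2 D Nf => h h1 h2 h0; split=> //; exact: h1.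
(* [r / 2] keeps [t] inside the neighbourhood; the cap 1 lets [t] be a convex weight. *)
pose t := Num.min (r / 2) 1.
have t0 : 0 < t by rewrite lt_min divr_gt0//=.
have tr : t < r by rewrite gt_min ltr_pdivrMr// mulr_natr mulr2n ltrDl r0.
have tb : ball_ Num.norm (0 : R) r t by rewrite /= sub0r normrN gtr0_norm.
have [h1 h2] := hr t tb (lt0r_neq0 t0).
exists t; rewrite t0 ge_min lexx orbT addrC; split=> //.
have -> : fine (f (t *: w + x)) - fine (f x) - t * '[p, w] = - (t * ('[p, w] - t^-1 *: ((F \o shift x) (t *: w) - F x))).
  by rewrite /F/= /GRing.scale/= mulrBr mulrA divff ?gt_eqF// mul1r; ring.
by rewrite normrN normrM gtr0_norm// mulrC ler_wpM2r// ltW.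
Qed.

Lemma gradient_fin f x p : is_gradient f x p -> f x \is a fin_num.
Proof. by move=> [/nbhs_singleton]. Qed.

Lemma gradient_subgradient f x p u : (forall v, f v != -oo%E) -> convex f ->
  is_gradient f x p -> f u \is a fin_num ->
  fine (f x) + '[p, u - x] <= fine (f u).
Proof.
move=> fN cf gf fu; apply/ler_addgt0Pr => e e0.
have fx := gradient_fin gf.
have [t [/andP[t0 t1] ft]] := gradient_slope (u - x) gf e0.
rewrite ler_norml => /andP[H _].
have [|_] := @strongly_convex_fine _ _ f 0 u x t fN cf _ fu fx.
  by rewrite ltW.
have -> : t *: u + (1 - t) *: x = x + t *: (u - x).
  by rewrite scalerBl scale1r scalerBr addrCA addrA addrAC -addrA addrC.
rewrite !mul0r addr0 => H2.
rewrite -(ler_pM2l t0); nra.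
Qed.

(* Fermat's rule for [g + h \o A]: only one-sided slopes are compared, so [g]
   need not be differentiable. *)
Lemma argmin_add_gradient (X : finHilbertType R) (A : {linear X -> V})
    (g : X -> \bar R) (h : V -> \bar R) (x : X) p :
  (forall u, g u != -oo%E) -> convex g ->
  g x \is a fin_num -> is_argmin (fun u => g u + h (A u))%E x ->
  is_gradient h (A x) p ->
  forall u, g u \is a fin_num ->
    fine (g x) + '[A x, p] <= fine (g u) + '[A u, p].
Proof.
move=> gN cg gx xmin gh u gu; apply/ler_addgt0Pr => e e0.
have hx := gradient_fin gh.
have [t [/andP[t0 t1] ht]] := gradient_slope (A u - A x) gh e0.
rewrite ler_norml => /andP[_ H].
have [|gt] := @strongly_convex_fine _ _ g 0 u x t gN cg _ gu gx.
  by rewrite ltW.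
have := xmin (t *: u + (1 - t) *: x).
have -> : A (t *: u + (1 - t) *: x) = A x + t *: (A u - A x).
  by rewrite linearD !linearZ/= scalerBl scale1r scalerBr addrCA.
rewrite -(fineK gx) -(fineK gt) -(fineK ht) -(fineK hx) -!EFinD lee_fin /=.
rewrite !mul0r addr0 => H1 H2; move: H; rewrite !innerE (innerC p) (innerC p) => H.
rewrite -(ler_pM2l t0); nra.
Qed.

End Gradient.

(** * Existence of minimisers by the direct method *)

Section LowerSemicontinuity.
Context {R : realType} {V : finHilbertType R}.
Implicit Types (f : V -> \bar R) (q : V -> R).
Local Open Scope ereal_scope.

Lemma lower_semicontinuousD f q : lower_semicontinuous f -> continuous q ->
  lower_semicontinuous (fun v => f v + (q v)%:E).
Proof.
move=> lf cq x a axq.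
(* The margin [e] absorbs the variation of [q] near [x]. *)
have [e e0 he] : exists2 e : R, (0 < e)%R & (a - q x + e)%:E < f x.
  move: axq; case: (f x) => [r| |]//.
  - rewrite -EFinD lte_fin => h; exists ((r + q x - a) / 2)%R; first by lra.
    by rewrite lte_fin; lra.
  - by move=> _; exists 1%R => //; exact: ltry.
have [U nU hU] := lf _ _ he.
have /cvgrPdist_lt/(_ _ e0) nq := cq x.
exists (U `&` [set t | (`|q x - q t| < e)%R]); first exact: filterI.
move=> y [/hU Uy /=]; rewrite ltr_norml => /andP[_ h].
move: Uy; case: (f y) => [r| |]//.
  by rewrite -EFinD !lte_fin; lra.
by move=> _; rewrite addye// ltry.
Qed.

(** If the infimum [m] were not attained, each point would have a neighbourhood on which [f] exceeds
    a level above [m]. Compactness makes one level work on a set containing the sublevel set of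
    [x0], which contradicts the definition of [m]. *)
Lemma lsc_coercive_argmin f (x0 : V) (k r : R) : lower_semicontinuous f ->
  f x0 < +oo -> (forall v, k%:E <= f v) ->
  (forall v, f v <= f x0 -> (`|v| <= r)%R) ->
  exists z, is_argmin f z.
Proof.
move=> lf fx0 fk fr.
pose m := ereal_inf (range f).
have fm v : m <= f v by apply: ereal_inf_lbound; exists v.
have mfin : m \is a fin_num.
  rewrite fin_numE -ltNye -ltey; apply/andP; split.
    by rewrite (lt_le_trans (ltNyr k))//; apply: le_ereal_inf_tmp => _ [v _ <-].
  exact: le_lt_trans (fm x0) fx0.
apply: contrapT => noz.
have fmlt v : m < f v.
  rewrite lt_neqAle fm andbT; apply/eqP => mE; apply: noz; exists v => u.
  by rewrite -mE.
have [K cK hK] := @finHilbert_closed_ball_compact R V r.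
have near_gt v : m < f v -> exists2 a : R, (fine m < a)%R & a%:E < f v.
  move=> h; have : exists a : R, m < a%:E < f v.
    move: h; rewrite -(fineK mfin); case: (f v) => [s| |]//.
      rewrite lte_fin => h; exists ((fine m + s) / 2)%R; rewrite !lte_fin; lra.
    by move=> _; exists (fine m + 1)%R; rewrite lte_fin ltry; lra.
  by move=> [a /andP[h1 h2]]; exists a => //; rewrite -lte_fin fineK.
have /compact_near_coveringP nc := cK.
have [b /= b0 hb] : \forall a \near at_right (fine m), K `<=` (fun v => a%:E < f v).
  apply: (nc R (at_right (fine m)) (fun a v => a%:E < f v)) => v _.
  have [a ma av] := near_gt v (fmlt v).
  have [U nU hU] := lf _ _ av.
  exists (U, [set b : R | (b < a)%R]); first by split => //; exact: nbhs_right_lt.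
  move=> [u b] [/= /hU Uu ba]; apply: lt_trans Uu; rewrite lte_fin//.
have [a ma ax0] := near_gt x0 (fmlt x0).
(* The first bound puts [c] below [a], hence below [f] off the sublevel set; the second puts it in
   the range where the covering argument applies. *)
pose c := Num.min ((fine m + a) / 2)%R (fine m + b / 2)%R.
have mc : (fine m < c)%R by rewrite lt_min; apply/andP; split; lra.
have ca : (c < a)%R by rewrite gt_min; apply/orP; left; lra.
have Kc : K `<=` (fun v => c%:E < f v).
  apply: hb => //=; rewrite ltr0_norm ?subr_lt0//.
  have : (c <= fine m + b / 2)%R by rewrite ge_min lexx orbT.
  by lra.
have : c%:E <= m.
  apply: le_ereal_inf_tmp => _ [v _ <-].
  have [/fr/hK/Kc/ltW//|/ltW h] := leP (f v) (f x0).
  apply: le_trans h; apply/ltW; apply: lt_trans ax0; rewrite lte_fin//.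
by rewrite leNgt -(fineK mfin) lte_fin mc.
Qed.

End LowerSemicontinuity.

Lemma continuous_norm_sub_sqr (R : realType) (V : normedModType R) (xi : V) :
  continuous (fun v : V => `|v - xi| ^+ 2)%R.
Proof.
move=> v; apply: (@continuous_comp _ _ _ (fun v => `|v - xi|)%R (fun s => s ^+ 2)%R).
  apply: (@continuous_comp _ _ _ (fun v => v - xi)%R (fun s => `|s|)%R).
    by apply: cvgB; [exact: cvg_id|exact: cvg_cst].
  exact: norm_continuous.
exact: exprn_continuous.
Qed.

(** * Quadratic upper model of [h] around a point [a] with subgradient [p] *)

Section Smoothness.
Context {R : realType} {V : finHilbertType R}.
Variables (h : V -> \bar R) (delta : R) (a p : V).
Hypotheses (hproper : proper h) (hconvex : convex h)
  (hlsc : lower_semicontinuous h) (delta_gt0 : (0 < delta)%R)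
  (hstrong : strongly_convex delta (conjugate h)) (ha : h a \is a fin_num)
  (hsub : forall u, h u \is a fin_num ->
     (fine (h a) + '[p, u - a] <= fine (h u))%R).
Local Open Scope ring_scope.

(** The affine minorant of slope [p] makes [h + c |. - xi|^2] bounded below and coercive. Optimality
    of a minimiser [z] says that [(2 * c) *: (xi - z)] is a subgradient of [h] at [z]. *)
Lemma prox_exists (c : R) (xi : V) : 0 < c -> exists z, [/\
  h z \is a fin_num &
  forall u, h u \is a fin_num ->
    fine (h z) + '[z - u, (2 * c) *: (z - xi)] <= fine (h u)].
Proof.
move=> c0.
pose k := fine (h a) + '[p, xi - a].
have hk v : ((k + '[p, v - xi])%:E <= h v)%E.
  have [hv|] := boolP (h v \is a fin_num).
    by rewrite -(fineK hv) lee_fin (le_trans _ (hsub hv))// /k !innerE; lra.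
  by have := hproper.1 v; case: (h v) => // _ _; exact: leey.
have hkn v : ((k - `|p| * `|v - xi|)%:E <= h v)%E.
  apply: le_trans (hk v); rewrite lee_fin lerD2l.
  by have := inner_le_norm p (- (v - xi)); rewrite normrN innerNr; lra.
have hlb v : ((k - `|p| * `|v - xi| + c * `|v - xi| ^+ 2)%:E <=
    h v + (c * `|v - xi| ^+ 2)%:E)%E.
  by rewrite EFinD leeD2r.
have [x0 hx0] := hproper.2.
pose M := fine (h x0) + c * `|x0 - xi| ^+ 2.
have hM : (h x0 + (c * `|x0 - xi| ^+ 2)%:E)%E = M%:E.
  by rewrite /M EFinD fineK// fin_real//; have := hproper.1 x0; rewrite -ltNye => ->.
have pn : 0 <= `|p| by [].
have [z zmin] : exists z, is_argmin (fun v => h v + (c * `|v - xi| ^+ 2)%:E)%E z.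
  (* The lower bound comes from completing the square in [k - |p| s + c s^2], with [s = |v - xi|].
     For [s] above [(|p| + |M - k|) / c + 1] this quadratic exceeds [M], the value at [x0]. *)
  apply: (@lsc_coercive_argmin _ _ _ x0 (k - `|p| ^+ 2 / (4 * c))
            ((`|p| + `|M - k|) / c + 1 + `|xi|)).
  - apply: lower_semicontinuousD => // v.
    by apply: cvgZl_tmp; exact: continuous_norm_sub_sqr.
  - by rewrite hM ltry.
  - move=> v; apply: le_trans (hlb v); rewrite lee_fin.
    move: `|v - xi| => s; rewrite -subr_ge0.
    have -> : k - `|p| * s + c * s ^+ 2 - (k - `|p| ^+ 2 / (4 * c)) =
      c * (s - `|p| / (2 * c)) ^+ 2 by field; rewrite gt_eqF.
    by rewrite mulr_ge0 ?sqr_ge0// ltW.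
  - move=> v; rewrite hM => hv; have := le_trans (hlb v) hv; rewrite lee_fin.
    have tri : `|v| <= `|v - xi| + `|xi|.
      by rewrite -{1}(subrK xi v) ler_normD.
    move=> H; apply: (le_trans tri); rewrite lerD2r leNgt; apply/negP => sl.
    move: sl; set s := `|v - xi| in H *.
    have : M - k <= `|M - k| by exact: ler_norm.
    have : 0 <= `|M - k| by [].
    move: `|M - k| => d d0 dM sl.
    have cs : `|p| + d + c < c * s.
      move: sl; rewrite -(ltr_pM2l c0) => /(le_lt_trans _); apply.
      by rewrite mulrDr mulr1 mulrC divfK ?gt_eqF.
    have s1 : 1 < s.
      by rewrite -(ltr_pM2l c0) mulr1; lra.
    have : d < s * (c * s - `|p|).
      apply: (@le_lt_trans _ _ (s * d)); first by rewrite ler_peMl// ltW.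
      by rewrite ltr_pM2l; lra.
    by move: H; rewrite expr2; lra.
have [|hz hzmin] := @argmin_strongly_convex _ _ V h 0 idfun 0 xi c z hproper hconvex.
  by move=> u /=; rewrite !inner0r !adde0; exact: zmin.
exists z; split=> // u hu; have := hzmin u hu.
by rewrite !mul0r addr0 add0r.
Qed.

(** By Fenchel equality [p] minimises the conjugate minus ['[a, .]], so strong convexity gives
    quadratic growth away from [p]. *)
Lemma conjugate_strong_growth q : conjugate h q \is a fin_num ->
  '[a, q] - fine (h a) + delta / 2 * `|q - p| ^+ 2 <= fine (conjugate h q).
Proof.
move=> cq.
have cp := conjugate_subgradient hproper ha hsub.
have cprop : proper (conjugate h).
  by split; [move=> y; exact: conjugate_gtNy|exists p; rewrite cp; exact: ltry].
have [|_ H] := @argmin_strongly_convex _ _ V (conjugate h) delta idfun (- a) 0 0 p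
    cprop hstrong.
  move=> u /=; rewrite !mul0r !adde0 cp -EFinD.
  have := conjugate_ge h a u; rewrite -(fineK ha) -EFinB.
  have := conjugate_gtNy u hproper.
  case: (conjugate h u) => [r _|_ _|//]; last by rewrite addye// leey.
  by rewrite -EFinD !lee_fin !innerE (innerC p a) (innerC u a); lra.
have := H q cq; rewrite cp /= mulr0 scale0r addr0 !innerE (innerC p a) (innerC q a).
lra.
Qed.

Let Q (u : V) := fine (h a) + '[p, u - a] + 1 / (2 * delta) * `|u - a| ^+ 2.

(** The proximal point [z] has the subgradient [q = (xi - z) / lam]; growth of the conjugate at [q]
    and Young's inequality give the quadratic bound. The distance estimate shows that [z] tends to
    [xi] with [lam]. *)
Lemma prox_smooth_bound (lam : R) (xi : V) : 0 < lam -> exists z, [/\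
  h z \is a fin_num, fine (h z) <= Q z &
  `|z - xi| <= lam * (`|p| + 2 / delta * (`|xi - a| + lam * `|p|))].
Proof.
move=> l0.
have [|z [hz zmin]] := @prox_exists (1 / (2 * lam)) xi.
  by rewrite divr_gt0// mulr_gt0.
pose q := lam^-1 *: (xi - z).
have zq : z = xi - lam *: q.
  by rewrite /q scalerA mulfV ?gt_eqF// scale1r opprB addrC subrK.
have qE : (2 * (1 / (2 * lam))) *: (z - xi) = - q.
  by rewrite /q -scalerN opprB; congr (_ *: _); field; rewrite gt_eqF.
clearbody q; have hq : conjugate h q = ('[z, q] - fine (h z))%:E.
  apply: conjugate_subgradient => // u hu; have := zmin u hu.
  by rewrite qE !innerE (innerC u) (innerC z); lra.
have := @conjugate_strong_growth q; rewrite hq => /(_ isT) /= H1.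
have H2 := hsub hz.
(* Monotonicity of subgradients between [a] and [z], obtained by adding [H1] and [H2]. *)
have H3 : delta / 2 * `|q - p| ^+ 2 <= '[z - a, q - p].
  by move: H1 H2; rewrite !innerE (innerC p z) (innerC p a); lra.
exists z; split => //.
  have E1 : '[z, q] = '[z - a, q - p] + '[p, z - a] + '[a, q].
    by rewrite !innerE (innerC p z) (innerC p a); lra.
  have := inner_ge0 (z - a - delta *: (q - p)).
  rewrite /Q; move: (z - a) (q - p) E1 H1 => b r E1 H1.
  rewrite !normr_inner !innerE (innerC r b) in H1 *.
  rewrite -(pmulr_rge0 _ (_ : 0 < (2 * delta)^-1)) ?invr_gt0 ?mulr_gt0// => H4.
  suff : 1 / (2 * delta) * '[b, b] - ('[b, r] - delta / 2 * '[r, r]) =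
    (2 * delta)^-1 * ('[b, b] - delta * '[b, r]
      + (- (delta * '[b, r]) - - (delta * (delta * '[r, r])))) by lra.
  by field; rewrite gt_eqF.
have nr : `|q - p| <= 2 / delta * (`|xi - a| + lam * `|p|).
  have [->|n0] := eqVneq (q - p) 0.
    rewrite normr0 mulr_ge0 ?divr_ge0 ?addr_ge0 ?mulr_ge0// ltW//.
  have np : 0 < `|q - p| by rewrite normr_gt0.
  have H5 := inner_le_norm (xi - a - lam *: p) (q - p).
  have H6 : `|xi - a - lam *: p| <= `|xi - a| + lam * `|p|.
    by rewrite (le_trans (ler_normB _ _))// normrZ gtr0_norm.
  have H7 : '[z - a, q - p] = '[xi - a - lam *: p, q - p] - lam * `|q - p| ^+ 2.
    by rewrite zq normr_inner !innerE; ring.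
  have : `|q - p| * (delta / 2 * `|q - p|) <= `|q - p| * (`|xi - a| + lam * `|p|).
    have : 0 <= lam * `|q - p| ^+ 2 by rewrite mulr_ge0// ltW.
    have : `|xi - a - lam *: p| * `|q - p| <= (`|xi - a| + lam * `|p|) * `|q - p|.
      by rewrite ler_wpM2r.
    lra.
  rewrite ler_pM2l// -(ler_pM2l (_ : 0 < 2 / delta)) ?divr_gt0//.
  by rewrite mulrA mulrA divfK ?gt_eqF// divff// mul1r.
rewrite zq addrAC subrr add0r normrN normrZ gtr0_norm// ler_pM2l//.
by rewrite -{1}(subrK p q) addrC (le_trans (ler_normD _ _))// lerD2l.
Qed.

(** If [h u > Q u], lower semicontinuity keeps [h > Q] on a ball around [u], yet proximal points of
    small parameter lie in that ball and satisfy [h <= Q]. *)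
Lemma conjugate_strongly_convex_smooth u : h u \is a fin_num /\
  fine (h u) <= fine (h a) + '[p, u - a] + 1 / (2 * delta) * `|u - a| ^+ 2.
Proof.
rewrite -/(Q u).
have cQ : continuous (fun v => - Q v).
  have QE v : Q v =
      (fine (h a) - delta / 2 * `|p| ^+ 2) + 1 / (2 * delta) * `|v - (a - delta *: p)| ^+ 2.
    rewrite /Q opprB addrA -addrAC !normr_inner !innerE (innerC a v) (innerC p v) (innerC p a).
    by field; rewrite gt_eqF.
  under eq_fun do rewrite QE.
  move=> v; apply: cvgN; apply: cvgD; first exact: cvg_cst.
  by apply: cvgZl_tmp; exact: continuous_norm_sub_sqr.
have [|hu] := leP (h u) (Q u)%:E.
  by move: (hproper.1 u); case: (h u) => // r _; rewrite lee_fin.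
exfalso.
have hQ : (0%:E < h u + (- Q u)%:E)%E.
  move: hu; case: (h u) => [r|_|//]; last by rewrite addye// ltry.
  by rewrite -EFinD !lte_fin; lra.
have [U nU hU] := @lower_semicontinuousD _ _ _ _ hlsc cQ u _ hQ.
have /nbhs_ballP[e /= e0 he] := nU.
(* [M] strictly dominates the factor of [lam] in the distance estimate whenever [lam <= 1], so
   [lam <= e / M] brings the proximal point within [e]. *)
pose M := `|p| + 2 / delta * (`|u - a| + 1 * `|p|) + 1.
have M0 : 0 < M.
  rewrite ltr_wpDl// addr_ge0// mulr_ge0 ?divr_ge0 ?addr_ge0 ?mulr_ge0// ltW//.
pose lam := Num.min 1 (e / M).
have l0 : 0 < lam by rewrite lt_min ltr01 divr_gt0.
have [z [hz hzQ zu]] := prox_smooth_bound u l0.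
have /he/hU : ball u e z.
  rewrite -ball_normE /ball_/= distrC (le_lt_trans zu)//.
  apply: (@lt_le_trans _ _ (lam * M)).
    rewrite ltr_pM2l// /M.
    have : 2 / delta * (`|u - a| + lam * `|p|) <= 2 / delta * (`|u - a| + 1 * `|p|).
      apply: ler_wpM2l; first by rewrite divr_ge0// ltW.
      by rewrite lerD2l ler_wpM2r// ge_min lexx.
    by lra.
  by rewrite -ler_pdivlMr// ge_min lexx orbT.
by rewrite -(fineK hz) -EFinD lte_fin; lra.
Qed.

End Smoothness.

(** * Energy and ergodic means *)

Section Energy.
Context {R : realType} {Y : finHilbertType R}.
Variables (tau tau' omega : R).
Local Open Scope ring_scope.
Hypotheses (tau_gt0 : 0 < tau) (tau'_gt0 : 0 < tau') (omega_gt0 : 0 < omega).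

Definition energy (xi v d : Y) : R :=
  1 / (2 * tau) * `|xi| ^+ 2 + tau' / 2 * `|v| ^+ 2
  + omega * tau' / 2 * `|d| ^+ 2 + omega * '[d, xi].

(** Completing the square in [d]; the discarded term is [omega / (2 tau') |xi + tau' d|^2]. *)
Lemma energy_ge xi v d :
  (1 - omega * tau / tau') * (1 / (2 * tau)) * `|xi| ^+ 2 + tau' / 2 * `|v| ^+ 2
    <= energy xi v d.
Proof.
rewrite -subr_ge0.
suff -> : energy xi v d -
    ((1 - omega * tau / tau') * (1 / (2 * tau)) * `|xi| ^+ 2 + tau' / 2 * `|v| ^+ 2)
    = omega / (2 * tau') * `|xi + tau' *: d| ^+ 2.
  by rewrite mulr_ge0 ?sqr_ge0// divr_ge0 ?mulr_ge0// ltW.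
rewrite /energy !normr_inner !innerE (innerC d xi); field.
by rewrite !gt_eqF.
Qed.

Lemma energy0 xi v :
  energy xi v 0 = 1 / (2 * tau) * `|xi| ^+ 2 + tau' / 2 * `|v| ^+ 2.
Proof. by rewrite /energy normr0 inner0l expr0n/= !mulr0 !addr0. Qed.

(* The difference of both sides is a nonnegative combination of [|e|^2], [|w|^2]
   and the squares [|c - omega tau d|^2] and [|e - omega tau d|^2]. *)
Lemma energy_decrease (gamma' delta : R) (c d e D w : Y) :
  omega * tau <= tau' ->
  tau' / tau + 1 <= omega * (tau * gamma' + 2) ->
  tau' <= omega * (tau' + delta) ->
  - (1 / tau) * '[c, e] + tau' / tau * '[d, e] - '[D, e] + tau' * '[D, w]
    - gamma' / 2 * `|e| ^+ 2 - delta / 2 * `|w| ^+ 2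
  <= energy (e - c) (w + D) d - omega^-1 * energy e w D.
Proof.
move=> h1 h2 h3; rewrite -subr_ge0.
set lhs := (X in 0 <= X).
have -> : lhs =
    (2 * (omega * tau))^-1 * (omega * (tau * gamma' + 2) - (tau' / tau + 1)) * `|e| ^+ 2
    + (2 * omega)^-1 * (omega * (tau' + delta) - tau') * `|w| ^+ 2
    + (2 * tau)^-1 * `|c - (omega * tau) *: d| ^+ 2
    + (2 * (omega * tau * tau))^-1 * (tau' - omega * tau) * `|e - (omega * tau) *: d| ^+ 2.
  rewrite /lhs /energy !normr_inner !innerE.
  rewrite (innerC e c) (innerC w D) (innerC d c) (innerC d e); field.
  by rewrite !gt_eqF.
by rewrite !addr_ge0// !mulr_ge0 ?sqr_ge0 ?invr_ge0 ?mulr_ge0 ?subr_ge0// ltW.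
Qed.

End Energy.

(** * Weights and Jensen's inequality for the ergodic means *)

Section ErgodicMeans.
Context {R : realType}.
Variable omega : R.
Local Open Scope ring_scope.
Hypothesis omega_gt0 : 0 < omega.
Local Notation T := (ergodic_weight omega).

Lemma ergodic_weightS N : T N.+1 = T N + omega ^- N.
Proof. by rewrite /ergodic_weight big_nat_recr. Qed.

Lemma ergodic_weight_ge N : omega ^- N <= T N.+1.
Proof.
rewrite ergodic_weightS lerDr; apply: sumr_ge0 => i _.
by rewrite invr_ge0 exprn_ge0// ltW.
Qed.

Lemma ergodic_weight_gt0 N : (1 <= N)%N -> 0 < T N.
Proof.
case: N => // N _; apply: lt_le_trans (ergodic_weight_ge N).
by rewrite invr_gt0 exprn_gt0.
Qed.

Lemma ergodic_weight_closed N : omega != 1 -> (1 <= N)%N ->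
  T N = (1 - omega ^+ N) / (omega ^+ N.-1 * (1 - omega)).
Proof.
move=> w1; have w1' : 1 - omega != 0 by rewrite subr_eq0 eq_sym.
have oN k : omega ^+ k != 0 by rewrite expf_neq0// gt_eqF.
elim: N => // -[_ _|N IH _].
  rewrite ergodic_weightS /ergodic_weight big_nil/= expr1 expr0 mul1r divff//.
  by rewrite add0r invr1.
rewrite ergodic_weightS IH//= !exprS.
by field; rewrite w1' oN gt_eqF.
Qed.

(** Identifies the coefficient in (i) with what remains of the telescoped sum after division by
    [T N], including the case [omega = 1]. *)
Lemma last_weightE N : (1 <= N)%N -> last_weight omega N = omega ^- N / T N.
Proof.
move=> N1; rewrite /last_weight; have [w1|w1] := eqVneq omega 1.
  rewrite w1 expr1n invr1; congr (_ / _).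
  rewrite /ergodic_weight (eq_bigr (fun=> 1)).
    by rewrite sumr_const_nat subn1.
  by move=> i _; rewrite expr1n invr1.
have w1' : 1 - omega != 0 by rewrite subr_eq0 eq_sym.
have oN k : omega ^+ k != 0 by rewrite expf_neq0// gt_eqF.
have := ergodic_weight_gt0 N1; rewrite ergodic_weight_closed//.
case: N N1 => // N _ T0 /=.
have n0 : 1 - omega ^+ N.+1 != 0.
  by apply: contraTneq T0 => ->; rewrite mul0r ltxx.
rewrite exprS in n0 *.
by field; rewrite w1' oN n0 gt_eqF.
Qed.

Lemma ergodic_meanE (V : lmodType R) (u : nat -> V) N : (1 <= N)%N ->
  T N *: ergodic_mean omega u N = \sum_(1 <= n < N.+1) omega ^- n.-1 *: u n.
Proof.
by move=> N1; rewrite scalerA mul1r divff ?scale1r// gt_eqF// ergodic_weight_gt0.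
Qed.

Lemma ergodic_mean_innerl (V : finHilbertType R) (u : nat -> V) v N : (1 <= N)%N ->
  T N * '[ergodic_mean omega u N, v] = \sum_(1 <= n < N.+1) omega ^- n.-1 * '[u n, v].
Proof.
move=> N1; rewrite -innerZl ergodic_meanE// linear_sumlz.
by apply: eq_bigr => i _; exact: innerZl.
Qed.

Lemma ergodic_mean_linear (V W : lmodType R) (A : {linear V -> W}) (u : nat -> V) N :
  A (ergodic_mean omega u N) = ergodic_mean omega (A \o u) N.
Proof.
rewrite linearZ/= linear_sum; congr (_ *: _).
by apply: eq_bigr => i _; rewrite linearZ.
Qed.

(** Induction on [N]: each mean is a convex combination of the previous mean and the new term, with
    weight [t = T N / T N.+1] on the former. The means start at index 1, so finiteness at [u 0] is
    not asked. *)
Lemma ergodic_jensen (V : finHilbertType R) (f : V -> \bar R) m (u : nat -> V) N :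
  (forall v, f v != -oo%E) -> 0 <= m -> strongly_convex m f ->
  (forall n, f (u n.+1) \is a fin_num) -> (1 <= N)%N ->
  f (ergodic_mean omega u N) \is a fin_num /\
  T N * fine (f (ergodic_mean omega u N))
    <= \sum_(1 <= n < N.+1) omega ^- n.-1 * fine (f (u n)).
Proof.
move=> fN m0 cf fu; elim: N => // -[_ _|N IH _].
  rewrite big_nat1 /ergodic_mean !ergodic_weightS /ergodic_weight big_nil big_nat1.
  by rewrite /= expr0 add0r invr1 divr1 !scale1r !mul1r.
have [//|fm hm] := IH; rewrite big_nat_recr//=.
set F := \sum_(_ <= _ < _) _ in hm *.
have T1 : 0 < T N.+1 by rewrite ergodic_weight_gt0.
have T2 : 0 < T N.+2 by rewrite ergodic_weight_gt0.
have w0 : 0 < omega ^- N.+1 by rewrite invr_gt0 exprn_gt0.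
have TS : T N.+2 = T N.+1 + omega ^- N.+1 by exact: ergodic_weightS.
pose t := T N.+1 / T N.+2.
have t01 : 0 <= t <= 1.
  by rewrite divr_ge0 ?(ltW T1) ?(ltW T2)//= ler_pdivrMr// mul1r TS lerDl ltW.
have tT : T N.+2 * t = T N.+1 by rewrite mulrC divfK// gt_eqF.
have tT' : T N.+2 * (1 - t) = omega ^- N.+1.
  by rewrite mulrBr mulr1 tT TS addrAC subrr add0r.
have mE : ergodic_mean omega u N.+2 =
    t *: ergodic_mean omega u N.+1 + (1 - t) *: u N.+2.
  apply: (@scalerI _ _ (T N.+2)); first by rewrite gt_eqF.
  rewrite ergodic_meanE// scalerDr (scalerA _ t) (scalerA _ (1 - t)) tT tT' ergodic_meanE//.
  by rewrite big_nat_recr.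
have [fm' hm'] := strongly_convex_fine fN cf t01 fm (fu N.+1).
clearbody t; rewrite mE; split=> //.
rewrite -(ler_pM2l T2) in hm'.
apply: (@le_trans _ _ (T N.+1 * fine (f (ergodic_mean omega u N.+1))
    + omega ^- N.+1 * fine (f (u N.+2)))); last by rewrite lerD2r.
rewrite -tT' -tT -!mulrA -mulrDr; apply: le_trans hm'.
rewrite ler_pM2l// lerDl.
have [t0 t1] := andP t01.
by rewrite !mulr_ge0 ?sqr_ge0 ?subr_ge0 ?invr_ge0.
Qed.

End ErgodicMeans.

(** * Optimal parameters *)

Section Rates.
Context {R : realType}.
Variables (L gamma delta : R).
Hypotheses (gamma_gt0 : (0 < gamma)%R) (delta_gt0 : (0 < delta)%R).
Local Open Scope ring_scope.

Lemma rate_conditionP tau tau' omega : 0 < tau' <= tau ->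
  rate_condition L gamma delta tau tau' omega ->
  [/\ 0 < omega, omega * tau <= tau',
      tau' / tau + 1 <= omega * (tau * (gamma / L ^+ 2) + 2) &
      tau' <= omega * (tau' + delta)].
Proof.
move=> /andP[tau'0 tt]; have tau0 : 0 < tau by exact: lt_le_trans tt.
rewrite /rate_condition ge_max -!andbA => /and3P[h1 h2 h3].
have p1 : 0 < tau * gamma / L ^+ 2 + 2.
  by rewrite ltr_wpDl// divr_ge0 ?sqr_ge0// mulr_ge0// ltW.
have p2 : 0 < delta / tau' + 1 by rewrite ltr_wpDl// divr_ge0// ltW.
split.
- by apply: lt_le_trans h2; rewrite divr_gt0.
- by rewrite -ler_pdivlMr.
- by rewrite mulrA -ler_pdivrMr.
- move: h2; rewrite ler_pdivrMr// -(ler_pM2r tau'0) mul1r => h.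
  apply: (le_trans h); rewrite -mulrA mulrDl divfK ?gt_eqF// mul1r addrC//.
Qed.

Hypothesis L_gt0 : 0 < L.
Let s := Num.sqrt (1 + 4 * L ^+ 2 / (gamma * delta)).
Let omegastar := (s - 1) / (s + 1).

Lemma optimal_sqrtP : 1 < s /\ gamma * delta * (s ^+ 2 - 1) = 4 * L ^+ 2.
Proof.
have gd : 0 < gamma * delta by rewrite mulr_gt0.
have r0 : 0 < 4 * L ^+ 2 / (gamma * delta) by rewrite divr_gt0// mulr_gt0// exprn_gt0.
split.
  rewrite -[ltLHS]sqrtr1 ltr_sqrt; lra.
rewrite sqr_sqrtr; last lra.
by rewrite addrAC subrr add0r mulrC divfK// gt_eqF.
Qed.

(** For [omega < 1], eliminating the step sizes leaves [(1 - omega)^2 L^2 <= omega gamma delta],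
    that is [(1 - omega)^2 (s^2 - 1) <= 4 omega], which fails below [omegastar]. *)
Lemma optimal_rate_le tau tau' omega : 0 < tau' <= tau ->
  rate_condition L gamma delta tau tau' omega -> omegastar <= omega.
Proof.
move=> tt rc; have [w0 h1 h2 h3] := rate_conditionP tt rc.
move: tt => /andP[tau'0 tt]; have tau0 : 0 < tau by exact: lt_le_trans tt.
have [s1 sE] := optimal_sqrtP.
have L2 : 0 < L ^+ 2 by rewrite exprn_gt0.
have gd : 0 < gamma * delta by rewrite mulr_gt0.
have sp : 0 < s + 1 by lra.
rewrite /omegastar ler_pdivrMr//.
have [w1|w1] := leP 1 omega; first by nra.
rewrite leNgt; apply/negP => hw.
have wt : omega <= tau' / tau by rewrite ler_pdivlMr.
have k1 : 1 - omega <= omega * tau * (gamma / L ^+ 2) by lra.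
have k2 : tau' * (1 - omega) <= omega * delta by lra.
have k3 : (1 - omega) * L ^+ 2 <= omega * tau * gamma.
  by rewrite -ler_pdivlMr//; lra.
have k4 : (omega * tau) * (1 - omega) <= omega * delta.
  by apply: le_trans k2; rewrite ler_wpM2r//; lra.
have k5 : tau * (1 - omega) <= delta by rewrite -(ler_pM2l w0); lra.
have k6 : (1 - omega) ^+ 2 * L ^+ 2 <= omega * gamma * delta.
  have : (1 - omega) * ((1 - omega) * L ^+ 2) <= (1 - omega) * (omega * tau * gamma).
    by rewrite ler_wpM2l//; lra.
  have : omega * gamma * (tau * (1 - omega)) <= omega * gamma * delta.
    by rewrite ler_wpM2l// mulr_ge0// ltW.
  lra.
have k7 : (1 - omega) ^+ 2 * (s ^+ 2 - 1) <= 4 * omega.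
  rewrite -(ler_pM2l gd).
  have -> : gamma * delta * ((1 - omega) ^+ 2 * (s ^+ 2 - 1)) =
    (1 - omega) ^+ 2 * (gamma * delta * (s ^+ 2 - 1)) by ring.
  rewrite sE; lra.
(* Both [q1] and [q2] restate [omega < omegastar]; their product contradicts [k7]. *)
have q1 : (1 - omega) * (s + 1) > 2 by lra.
have q2 : (1 - omega) * (s - 1) > 2 * omega by nra.
nra.
Qed.

(** Here [tau * gamma / L^2] and [delta / tau'] both equal [2 / (s - 1)], so every bound in the two
    conditions except the upper bound 1 collapses to [omegastar]. *)
Lemma optimal_steps tau tau' :
  tau = delta / 2 * (1 + s) -> 1 / tau' = gamma / (2 * L ^+ 2) * (1 + s) ->
  [/\ 0 < tau' <= tau, step_condition L gamma delta tau tau',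
      rate_condition L gamma delta tau tau' omegastar & tau' / tau = omegastar].
Proof.
move=> tauE tau'E.
have [s1 sE] := optimal_sqrtP.
have L2 : 0 < L ^+ 2 by rewrite exprn_gt0.
have sp : 0 < 1 + s by lra.
have sm : 0 < s - 1 by lra.
have tau0 : 0 < tau by rewrite tauE mulr_gt0 ?divr_gt0.
have tau'i : 0 < tau'^-1.
  by rewrite -[ltRHS]mul1r tau'E mulr_gt0// divr_gt0// mulr_gt0.
have tau'0 : 0 < tau' by rewrite -invr_gt0.
have L2E : L ^+ 2 = gamma * delta * (s ^+ 2 - 1) / 4 by rewrite sE; field.
have tau'V : tau' = (2 * L ^+ 2) / (gamma * (1 + s)).
  rewrite -[LHS]invrK -[tau'^-1]mul1r tau'E; field.
  by rewrite !gt_eqF.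
have sn : s ^+ 2 - 1 != 0 by rewrite (_ : _ - 1 = (s - 1) * (1 + s)) ?gt_eqF ?mulr_gt0//; ring.
have sm0 : s - 1 != 0 by rewrite gt_eqF.
have sp0 : 1 + s != 0 by rewrite gt_eqF.
have sp1 : s + 1 != 0 by rewrite addrC.
have s0 : s != 0 by rewrite gt_eqF// (lt_trans ltr01).
have gn : gamma != 0 by rewrite gt_eqF.
have dn : delta != 0 by rewrite gt_eqF.
have thE : tau' / tau = omegastar.
  rewrite tau'V tauE L2E /omegastar; field.
  by rewrite ?sm0 ?sp0 ?sp1 ?gn ?dn ?sn ?s0.
have aE : tau * gamma / L ^+ 2 = 2 / (s - 1).
  rewrite tauE L2E; field.
  by rewrite ?sm0 ?sp0 ?sp1 ?gn ?dn ?sn ?s0.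
have bE : delta / tau' = 2 / (s - 1).
  rewrite tau'V L2E; field.
  by rewrite ?sm0 ?sp0 ?sp1 ?gn ?dn ?sn ?s0.
have w01 : 0 < omegastar <= 1.
  by rewrite /omegastar divr_gt0 ?ler_pdivrMr//=; lra.
have oE : 1 / (2 / (s - 1) + 1) = omegastar.
  rewrite /omegastar; field.
  by rewrite ?sm0 ?sp0 ?sp1 ?gn ?dn ?sn ?s0.
have oE2 : (omegastar + 1) / (2 / (s - 1) + 2) = omegastar.
  have s2 : 2 + 2 * (s - 1) != 0 by rewrite (_ : _ + _ = 2 * s) ?mulf_neq0//; ring.
  by rewrite /omegastar; field; rewrite sm0 sp1 s2.
have [w0 w1] := andP w01.
split=> //.
- by rewrite tau'0/=; move: w1; rewrite -thE ler_pdivrMr// mul1r.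
- by rewrite /step_condition aE bE thE oE maxxx lexx.
- by rewrite /rate_condition aE bE thE oE oE2 maxxx lexx.
Qed.

End Rates.

(** * The ADMM iteration *)

Section ADMM.
Context {R : realType} {X Y : finHilbertType R}.
Variables (A : {linear X -> Y}) (g : X -> \bar R) (h : Y -> \bar R).
Variables (gamma delta : R).
Hypotheses (gproper : proper g) (hproper : proper h) (hconvex : convex h)
  (gamma_gt0 : (0 < gamma)%R) (gstrong : strongly_convex gamma g)
  (delta_gt0 : (0 < delta)%R) (hstrong : strongly_convex delta (conjugate h)).
Local Open Scope ring_scope.
Local Notation L := (opnorm A).

Definition rlagrangian (u : X) (v : Y) : R :=
  fine (g u) + '[A u, v] - fine (conjugate h v).

Lemma lagrangian_fin u v : g u \is a fin_num -> conjugate h v \is a fin_num ->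
  lagrangian A g h u v = (rlagrangian u v)%:E.
Proof. by move=> gu cv; rewrite /lagrangian /rlagrangian EFinB EFinD !fineK. Qed.

(** One-step energy inequality. The vector [d0] is free here; the iteration takes it to be the
    previous dual increment. *)
Lemma admm_step (tau tau' omega : R) (x1 : X) (z0 y0 d0 z1 y1 : Y) :
  0 < tau' <= tau -> rate_condition L gamma delta tau tau' omega ->
  is_argmin (fun u : X => g u + '[A u, y0]%:E
     + (1 / (2 * tau) * `|A u - z0| ^+ 2)%:E)%E x1 ->
  is_argmin (fun w : Y => h w - '[w, y0]%:E
     + (1 / (2 * tau') * `|A x1 - w| ^+ 2)%:E)%E z1 ->
  y1 = y0 + (1 / tau') *: (A x1 - z1) ->
  [/\ g x1 \is a fin_num, conjugate h y1 \is a fin_num &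
  forall u v, g u \is a fin_num -> conjugate h v \is a fin_num ->
    rlagrangian x1 v - rlagrangian u y1 <=
    energy tau tau' omega (A u - (z0 + tau' *: d0)) (v - y0) d0
    - omega^-1 * energy tau tau' omega (A u - A x1) (v - y1) (y1 - y0)].
Proof.
move=> tt rc xmin zmin y1E; have [w0 h1 h2 h3] := rate_conditionP gamma_gt0 delta_gt0 tt rc.
move: tt => /andP[tau'0 tt]; have tau0 : 0 < tau by exact: lt_le_trans tt.
have [gx1 Hx] := argmin_strongly_convex gproper gstrong xmin.
have [|hz1 Hz] := @argmin_strongly_convex _ _ Y h 0 idfun (- y0) (A x1)
    (1 / (2 * tau')) z1 hproper hconvex.
  by move=> w /=; rewrite !innerNr (distrC w) (distrC z1); exact: zmin.
have zE : z1 = A x1 - tau' *: (y1 - y0).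
  by rewrite y1E addrAC subrr add0r scalerA mulrC mul1r mulVf ?gt_eqF// scale1r opprB addrC subrK.
have y1E' : - y0 + (2 * (1 / (2 * tau'))) *: (z1 - A x1) = - y1.
  rewrite y1E opprD -scalerN opprB; congr (_ + _ *: _).
  by field; rewrite gt_eqF.
(* Optimality of the z-step says that the updated multiplier [y1] is a subgradient of [h] at [z1],
   so the conjugate grows quadratically away from [y1]. *)
have sub w : h w \is a fin_num -> fine (h z1) + '[y1, w - z1] <= fine (h w).
  move=> /Hz; rewrite /= y1E' !mul0r addr0 !innerE (innerC w) (innerC z1); lra.
have cy1 := conjugate_subgradient hproper hz1 sub.
split=> //; first by rewrite cy1.
move=> u v gu cv.
have growth := conjugate_strong_growth hproper hstrong hz1 sub cv.
have := energy_decrease tau0 w0 (z0 + tau' *: d0 - A x1) d0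
  (A u - A x1) (y1 - y0) (v - y1) h1 h2 h3.
have -> : A u - A x1 - (z0 + tau' *: d0 - A x1) = A u - (z0 + tau' *: d0).
  by rewrite opprB addrA subrK.
have -> : v - y1 + (y1 - y0) = v - y0 by rewrite addrA subrK.
(* The gain [gamma] in [X] becomes a gain [gamma / L^2] on images under [A], the only quantities in
   the energy. *)
apply: le_trans; have := opnorm_sqr_le A (u - x1) gamma_gt0; rewrite linearB/=.
have := Hx u gu; rewrite /rlagrangian cy1/=.
move: growth; have -> : '[z1, v] = '[A x1 - tau' *: (y1 - y0), v] by rewrite -zE.
have -> : '[z1, y1] = '[A x1 - tau' *: (y1 - y0), y1] by rewrite -zE.
rewrite (_ : 2 * (1 / (2 * tau)) = 1 / tau); last by field; rewrite gt_eqF.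
have -> : '[A x1 - A u, y0 + (1 / tau) *: (A x1 - z0)] =
    '[A x1 - A u, y1 - (y1 - y0) + (1 / tau) *: (A x1 - z0)] by rewrite subKr.
move: (y1 - y0) (fine (conjugate h v)) (fine (g u)) (fine (g x1)) (fine (h z1)).
move=> D cv' gu' gx' hz'.
move: (`|u - x1| ^+ 2) (`|v - y1| ^+ 2) (`|A u - A x1| ^+ 2) => nx nv na.
rewrite !innerE.
rewrite (innerC D v) (innerC D y1) (innerC (A u) y1) (innerC (A x1) y1).
rewrite (innerC D (A u)) (innerC D (A x1)) (innerC z0 (A u)) (innerC z0 (A x1)).
rewrite (innerC (A x1) (A u)).
lra.
Qed.

Section Iterates.
Variables (tau tau' omega : R) (x : nat -> X) (z y : nat -> Y).
Hypotheses (tautau' : 0 < tau' <= tau)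
  (rate : rate_condition L gamma delta tau tau' omega)
  (iter : admm A g h tau tau' x z y).
Local Notation T := (ergodic_weight omega).
Local Notation XN := (ergodic_mean omega x).
Local Notation YN := (ergodic_mean omega y).

Let omega_gt0 : 0 < omega.
Proof. by have [] := rate_conditionP gamma_gt0 delta_gt0 tautau' rate. Qed.

Let tau'_gt0 : 0 < tau'.
Proof. by case/andP: tautau'. Qed.

Let tau_gt0 : 0 < tau.
Proof. by case/andP: tautau' => t0; exact: lt_le_trans. Qed.

Lemma admm_primal_fin n : g (x n.+1) \is a fin_num.
Proof.
by have [h1 h2 h3] := iter n; have [] := admm_step 0 tautau' rate h1 h2 h3.
Qed.

Lemma admm_dual_fin n : conjugate h (y n.+1) \is a fin_num.
Proof.
by have [h1 h2 h3] := iter n; have [] := admm_step 0 tautau' rate h1 h2 h3.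
Qed.

Let d n := if n is k.+1 then y k.+1 - y k else 0.

(* [z n + tau' *: d n] is [A (x n)] for [n >= 1] and [z 0] for [n = 0], so that
   [z 0] need not be the image of [x 0]. *)
Let E u v n := energy tau tau' omega (A u - (z n + tau' *: d n)) (v - y n) (d n).

Let zdE n : z n.+1 + tau' *: d n.+1 = A (x n.+1).
Proof.
rewrite /d; have [_ _ ->] := iter n.
by rewrite addrAC subrr add0r scalerA mulrC mul1r mulVf ?gt_eqF// scale1r addrC subrK.
Qed.

Lemma admm_telescope u v N : g u \is a fin_num -> conjugate h v \is a fin_num ->
  \sum_(1 <= n < N.+1) omega ^- n.-1 * (rlagrangian (x n) v - rlagrangian u (y n))
    <= E u v 0 - omega ^- N * E u v N.
Proof.
move=> gu cv; elim: N => [|N IH].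
  by rewrite big_nil expr0 invr1 mul1r subrr.
rewrite big_nat_recr//=.
have [h1 h2 h3] := iter N.
have [_ _ /(_ u v gu cv)] := admm_step (d N) tautau' rate h1 h2 h3.
rewrite -zdE -/(d N.+1) -/(E u v N) -/(E u v N.+1) => H.
have wN : 0 < omega ^- N by rewrite invr_gt0 exprn_gt0.
rewrite -(ler_pM2l wN) in H.
rewrite exprS invfM; lra.
Qed.

Lemma admm_ergodic_fin N : (1 <= N)%N ->
  g (XN N) \is a fin_num /\ conjugate h (YN N) \is a fin_num.
Proof.
move=> N1; split.
  by have [] := ergodic_jensen omega_gt0 gproper.1 (ltW gamma_gt0) gstrong admm_primal_fin N1.
have cN v := conjugate_gtNy v hproper.
by have [] := ergodic_jensen omega_gt0 cN (ltW delta_gt0) hstrong admm_dual_fin N1.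
Qed.

Lemma admm_gap u v N : (1 <= N)%N -> g u \is a fin_num ->
  conjugate h v \is a fin_num ->
  omega ^- N * ((1 - omega * tau / tau') * (1 / (2 * tau)) * `|A u - A (x N)| ^+ 2
    + tau' / 2 * `|v - y N| ^+ 2)
  + T N * (rlagrangian (XN N) v - rlagrangian u (YN N))
  <= 1 / (2 * tau) * `|A u - z 0%N| ^+ 2 + tau' / 2 * `|v - y 0%N| ^+ 2.
Proof.
move=> N1 gu cv.
have [_ gJ] := ergodic_jensen omega_gt0 gproper.1 (ltW gamma_gt0) gstrong admm_primal_fin N1.
have cN w := conjugate_gtNy w hproper.
have [_ cJ] := ergodic_jensen omega_gt0 cN (ltW delta_gt0) hstrong admm_dual_fin N1.
have AX : T N * '[A (XN N), v] = \sum_(1 <= n < N.+1) omega ^- n.-1 * '[A (x n), v].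
  by rewrite ergodic_mean_linear ergodic_mean_innerl.
have AY : T N * '[A u, YN N] = \sum_(1 <= n < N.+1) omega ^- n.-1 * '[A u, y n].
  rewrite innerC ergodic_mean_innerl//.
  by apply: eq_bigr => n _; rewrite innerC.
have Tc c : T N * c = \sum_(1 <= n < N.+1) omega ^- n.-1 * c.
  by rewrite /ergodic_weight mulr_suml.
have := admm_telescope N gu cv.
have E0 : E u v 0 = 1 / (2 * tau) * `|A u - z 0%N| ^+ 2 + tau' / 2 * `|v - y 0%N| ^+ 2.
  by rewrite /E/= scaler0 addr0 energy0.
have EN : (1 - omega * tau / tau') * (1 / (2 * tau)) * `|A u - A (x N)| ^+ 2
    + tau' / 2 * `|v - y N| ^+ 2 <= E u v N.
  by case: N N1 {gJ cJ AX AY Tc} => // N _; rewrite /E zdE; exact: energy_ge.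
rewrite E0 => tel.
have wN : 0 < omega ^- N by rewrite invr_gt0 exprn_gt0.
rewrite -(ler_pM2l wN) in EN.
(* The bilinear terms pass to the means exactly; only the sums of [g] and of the conjugate need
   Jensen. *)
have SE : \sum_(1 <= n < N.+1) omega ^- n.-1 * (rlagrangian (x n) v - rlagrangian u (y n))
  = \sum_(1 <= n < N.+1) omega ^- n.-1 * fine (g (x n))
    + T N * '[A (XN N), v] - T N * fine (conjugate h v)
    - (T N * fine (g u) + T N * '[A u, YN N]
       - \sum_(1 <= n < N.+1) omega ^- n.-1 * fine (conjugate h (y n))).
  rewrite AX AY !Tc -big_split -sumrB -big_split -sumrB -sumrB /=.
  by apply: eq_bigr => n _; rewrite /rlagrangian; ring.
rewrite SE in tel; rewrite [in X in _ + X]/rlagrangian.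
lra.
Qed.

End Iterates.

End ADMM.

(** * The saddle point *)

Section Saddle.
Context {R : realType} {X Y : finHilbertType R}.
Variables (A : {linear X -> Y}) (g : X -> \bar R) (h : Y -> \bar R).
Variables (gamma delta : R) (xstar : X) (ystar : Y).
Hypotheses (gproper : proper g) (gconvex : convex g)
  (hproper : proper h) (hconvex : convex h) (hlsc : lower_semicontinuous h)
  (gamma_gt0 : (0 < gamma)%R) (gstrong : strongly_convex gamma g)
  (delta_gt0 : (0 < delta)%R) (hstrong : strongly_convex delta (conjugate h))
  (xstar_min : is_argmin (objective A g h) xstar)
  (ystar_grad : is_gradient h (A xstar) ystar).
Local Open Scope ring_scope.
Local Notation L := (opnorm A).
Local Notation Lr := (rlagrangian A g h).

Let hfin : h (A xstar) \is a fin_num.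
Proof. exact: gradient_fin ystar_grad. Qed.

Let hsub w : h w \is a fin_num ->
  fine (h (A xstar)) + '[ystar, w - A xstar] <= fine (h w).
Proof. exact: (gradient_subgradient hproper.1 hconvex ystar_grad). Qed.

Let smooth w := conjugate_strongly_convex_smooth hproper hconvex hlsc delta_gt0
  hstrong hfin hsub w.

(** Compare with a point where [g] is finite: the quadratic model makes [h] finite everywhere, so
    the objective is finite there. *)
Lemma minimizer_fin : g xstar \is a fin_num.
Proof.
have [gN [x0 gx0]] := gproper.
have gx : g x0 \is a fin_num by have := gN x0; move: gx0; case: (g x0).
have := xstar_min x0; have := gN xstar; rewrite /objective.
rewrite -(fineK gx) -(fineK (smooth (A x0)).1) -(fineK hfin) -EFinD.
by case: (g xstar).
Qed.

Lemma saddle_conjugate :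
  conjugate h ystar = ('[A xstar, ystar] - fine (h (A xstar)))%:E.
Proof. exact: (conjugate_subgradient hproper hfin hsub). Qed.

Lemma saddle_dual v : conjugate h v \is a fin_num -> Lr xstar v <= Lr xstar ystar.
Proof.
move=> cv; have := conjugate_ge h (A xstar) v.
rewrite -(fineK cv) -(fineK hfin) -EFinB lee_fin /rlagrangian saddle_conjugate/=.
lra.
Qed.

(** By Fermat's rule [xstar] minimises [g + '[A ., ystar]], and strong convexity adds the quadratic
    growth. *)
Lemma saddle_primal u : g u \is a fin_num ->
  Lr xstar ystar + gamma / 2 * `|u - xstar| ^+ 2 <= Lr u ystar.
Proof.
move=> gu.
have [|_ H] := @argmin_strongly_convex _ _ Y g gamma A ystar 0 0 xstar gproper gstrong.
  move=> v; rewrite !mul0r !adde0.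
  have [gv|] := boolP (g v \is a fin_num).
    rewrite -(fineK gv) -(fineK minimizer_fin) -!EFinD lee_fin.
    exact: (argmin_add_gradient gproper.1 gconvex minimizer_fin xstar_min ystar_grad).
  have := gproper.1 v; case: (g v) => // _ _.
  by rewrite addye// leey.
have := H u gu; rewrite /rlagrangian mulr0 scale0r addr0 !innerE; lra.
Qed.

Lemma objective_gap u : g u \is a fin_num ->
  [/\ objective A g h u \is a fin_num, objective A g h xstar \is a fin_num &
  fine (objective A g h u) - fine (objective A g h xstar) <=
  (1 + L ^+ 2 / (gamma * delta)) * (Lr u ystar - Lr xstar ystar)].
Proof.
move=> gu; have [hu hb] := smooth (A u); rewrite /= in hb.
have gx := minimizer_fin.
rewrite /objective -(fineK gu) -(fineK hu) -(fineK gx) -(fineK hfin) -!EFinD.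
split=> //=.
have S := saddle_primal gu.
(* The curvature term of the model of [h] is at most [L^2 / (gamma delta)] times the growth term of
   [saddle_primal], hence times the Lagrangian gap. *)
have B : 1 / (2 * delta) * `|A u - A xstar| ^+ 2 <=
    L ^+ 2 / (gamma * delta) * (gamma / 2 * `|u - xstar| ^+ 2).
  rewrite -linearB.
  have -> : L ^+ 2 / (gamma * delta) * (gamma / 2 * `|u - xstar| ^+ 2) =
    1 / (2 * delta) * (L * `|u - xstar|) ^+ 2.
    by field; rewrite !gt_eqF.
  apply: ler_wpM2l; first by rewrite divr_ge0// mulr_ge0// ltW.
  by rewrite lerXn2r ?nnegrE ?mulr_ge0 ?opnorm_ge0// le_opnorm.
have k0 : 0 <= L ^+ 2 / (gamma * delta).
  by rewrite divr_ge0 ?sqr_ge0// ltW// mulr_gt0.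
have S2 : gamma / 2 * `|u - xstar| ^+ 2 <= Lr u ystar - Lr xstar ystar by lra.
have S3 := ler_wpM2l k0 S2.
have n0 : 0 <= gamma / 2 * `|u - xstar| ^+ 2.
  by rewrite mulr_ge0 ?sqr_ge0// divr_ge0// ltW.
have GE : Lr u ystar - Lr xstar ystar =
    fine (g u) - fine (g xstar) + '[ystar, A u - A xstar].
  by rewrite /rlagrangian innerDr innerNr (innerC ystar) (innerC ystar); ring.
move: (Lr u ystar - Lr xstar ystar) S2 S3 GE => G S2 S3 GE.
rewrite mulrDl mul1r; lra.
Qed.

End Saddle.

(** * Transfer between real-valued and extended-valued Lagrangian gaps *)

Section ExtendedLagrangian.
Context {R : realType} {X Y : finHilbertType R}.
Variables (A : {linear X -> Y}) (g : X -> \bar R) (h : Y -> \bar R).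
Hypotheses (gproper : proper g) (hproper : proper h).
Variables (u0 : X) (v0 : Y).
Hypotheses (gu0 : g u0 \is a fin_num) (cv0 : conjugate h v0 \is a fin_num).
Local Open Scope ereal_scope.

Lemma lagrangian_gtNy u : lagrangian A g h u v0 != -oo.
Proof.
rewrite /lagrangian -(fineK cv0).
by have := gproper.1 u; case: (g u).
Qed.

Lemma lagrangian_lty v : lagrangian A g h u0 v != +oo.
Proof.
rewrite /lagrangian -(fineK gu0).
by have := conjugate_gtNy v hproper; case: (conjugate h v).
Qed.

(** Outside the domains of [g] and of the conjugate the difference is [-oo], so only finite values
    have to be bounded. *)
Lemma lagrangian_gap_le u v (B : R) :
  (g u \is a fin_num -> conjugate h v \is a fin_num ->
   (rlagrangian A g h u0 v - rlagrangian A g h u v0 <= B)%R) ->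
  lagrangian A g h u0 v - lagrangian A g h u v0 <= B%:E.
Proof.
move=> H.
have [gu|gu] := boolP (g u \is a fin_num); last first.
  have -> : lagrangian A g h u v0 = +oo.
    rewrite /lagrangian -(fineK cv0).
    by have := gproper.1 u; move: gu; case: (g u).
  by have := lagrangian_lty v; case: (lagrangian A g h u0 v) => //= *; exact: leNye.
have [cv|cv] := boolP (conjugate h v \is a fin_num); last first.
  have -> : lagrangian A g h u0 v = -oo.
    rewrite /lagrangian -(fineK gu0).
    by have := conjugate_gtNy v hproper; move: cv; case: (conjugate h v).
  by rewrite addNye leNye.
by rewrite !lagrangian_fin// -EFinB lee_fin H.
Qed.

Lemma lagrangian_gap_ge0 u v :
  lagrangian A g h u v0 <= lagrangian A g h u0 v ->
  0 <= lagrangian A g h u0 v - lagrangian A g h u v0.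
Proof.
have := lagrangian_gtNy u; have := lagrangian_lty v.
case: (lagrangian A g h u0 v) => [r _|//|_]; case: (lagrangian A g h u v0) => // r' _.
by rewrite -EFinB !lee_fin subr_ge0.
Qed.

End ExtendedLagrangian.

(** * Assembly of the estimates, the convergence rates and the optimal parameters *)

Theorem mainTheorem5 (R : realType) (X Y : finHilbertType R)
  (A : {linear X -> Y}) (g : X -> \bar R) (h : Y -> \bar R) (gamma delta : R)
  (xstar : X) (ystar : Y)
  (gproper : proper g) (gconvex : convex g) (glsc : lower_semicontinuous g)
  (hproper : proper h) (hconvex : convex h) (hlsc : lower_semicontinuous h)
  (gamma_gt0 : (0 < gamma)%R) (gstrong : strongly_convex gamma g)
  (delta_gt0 : (0 < delta)%R) (hstrong : strongly_convex delta (conjugate h))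
  (xstar_min : is_argmin (objective A g h) xstar)
  (ystar_grad : is_gradient h (A xstar) ystar) :
  let L := opnorm A in
  let f := objective A g h in
  let l := lagrangian A g h in
  let zstar := A xstar in
  (forall (tau tau' omega : R) (x : nat -> X) (z y : nat -> Y),
    (0 < tau' <= tau)%R ->
    step_condition L gamma delta tau tau' ->
    admm A g h tau tau' x z y ->
    rate_condition L gamma delta tau tau' omega ->
    let T := ergodic_weight omega in
    let XN := ergodic_mean omega x in
    let YN := ergodic_mean omega y in
    let K := last_weight omega in
    let lhs N u v :=
      (K N * (1 - omega * tau / tau') * (1 / (2 * tau))
         * `|A u - A (x N)| ^+ 2)%:E
      + (K N * (tau' / 2) * `|v - y N| ^+ 2)%:E
      + (l (XN N) v - l u (YN N)) in
    let rhs N (xi : Y) u v :=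
      (1 / T N * (1 / (2 * tau)) * `|A u - xi| ^+ 2)%:E
      + (1 / T N * (tau' / 2) * `|v - y 0%N| ^+ 2)%:E in
    [/\ (* (i) *)
        forall N, (1 <= N)%N ->
          [/\ omega != 1%R ->
                T N = ((1 - omega ^+ N) / (omega ^+ N.-1 * (1 - omega)))%R,
              z 0%N = A (x 0%N) ->
                forall u v, lhs N u v <= rhs N (A (x 0%N)) u v,
              forall u v, lhs N u v <= rhs N (z 0%N) u v,
              forall u v, l u (YN N) <= l (XN N) v -> 0 <= lhs N u v
            & l xstar (YN N) <= l (XN N) ystar /\ 0 <= lhs N xstar ystar],
        (* (ii) *)
        exists C : R, forall N, (1 <= N)%N ->
          0 <= f (XN N) - f xstar <= (C * omega ^+ N)%:E /\
          (`|y N - ystar| ^+ 2 <= C * omega ^+ N)%R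
      & (1 - omega * tau / tau' != 0)%R ->
        exists C : R, forall N, (1 <= N)%N ->
          (`|z N - zstar| ^+ 2 <= C * omega ^+ N)%R])
  /\ (* (iii) *)
  ((0 < L)%R ->
   let s := Num.sqrt (1 + 4 * L ^+ 2 / (gamma * delta))%R in
   let omegastar := ((s - 1) / (s + 1))%R in
   (forall tau tau' omega : R, (0 < tau' <= tau)%R ->
      step_condition L gamma delta tau tau' ->
      rate_condition L gamma delta tau tau' omega -> (omegastar <= omega)%R)
   /\
   (forall tau tau' : R,
      tau = (delta / 2 * (1 + s))%R ->
      (1 / tau' = gamma / (2 * L ^+ 2) * (1 + s))%R ->
      [/\ (0 < tau' <= tau)%R,
          step_condition L gamma delta tau tau',
          rate_condition L gamma delta tau tau' omegastar
        & (tau' / tau)%R = omegastar])).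
Proof.
move=> L f l zstar.
split; last first.
  move=> L0; split.
    by move=> tau tau' omega tt _ rc; exact: optimal_rate_le tt rc.
  by move=> tau tau' tauE tau'E; exact: optimal_steps.
move=> tau tau' omega x z y tt _ iter rc T XN YN K lhs rhs.
have [w0 h1 h2 h3] := rate_conditionP gamma_gt0 delta_gt0 tt rc.
have [tau'0 tle] := andP tt.
have tau0 : (0 < tau)%R by exact: lt_le_trans tle.
have T0 N : (1 <= N)%N -> (0 < T N)%R by move=> N1; exact: ergodic_weight_gt0.
have k0 : (0 <= 1 - omega * tau / tau')%R.
  by rewrite subr_ge0 ler_pdivrMr// mul1r.
have wN N : (0 < omega ^- N)%R by rewrite invr_gt0 exprn_gt0.
have fins N := admm_ergodic_fin gproper hproper hconvex gamma_gt0 gstrong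
  delta_gt0 hstrong tt rc iter (N := N).
have gap u v N := admm_gap gproper hproper hconvex gamma_gt0 gstrong
  delta_gt0 hstrong tt rc iter (u := u) (v := v) (N := N).
have gxs := minimizer_fin gproper hproper hconvex hlsc delta_gt0 hstrong
  xstar_min ystar_grad.
have cys : conjugate h ystar \is a fin_num.
  by rewrite (saddle_conjugate hproper hconvex ystar_grad).
have sadd v : conjugate h v \is a fin_num ->
    (rlagrangian A g h xstar v <= rlagrangian A g h xstar ystar)%R.
  by move=> cv; exact: (saddle_dual g hproper hconvex ystar_grad cv).
have sadp u : g u \is a fin_num -> (rlagrangian A g h xstar ystar
    + gamma / 2 * `|u - xstar| ^+ 2 <= rlagrangian A g h u ystar)%R.
  by move=> gu; exact: (saddle_primal gproper gconvex hproper hconvex hlsc gstrong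
    delta_gt0 hstrong xstar_min ystar_grad gu).
have upper N : (1 <= N)%N -> forall u v, lhs N u v <= rhs N (z 0%N) u v.
  move=> N1 u v; have [gX cY] := fins N N1; rewrite /lhs /rhs.
  set c := (1 / T N * (1 / (2 * tau)) * _)%R; set c' := (1 / T N * (tau' / 2) * _)%R.
  set a := (K N * _ * _ * _)%R; set a' := (K N * _ * _)%R.
  (* Isolates the Lagrangian gap, the only term that may be infinite. *)
  have -> : c%:E + c'%:E = a%:E + a'%:E + (c + c' - (a + a'))%:E.
    by rewrite -!EFinD; congr _%:E; ring.
  rewrite leeD2l//; apply: lagrangian_gap_le => // gu cv.
  rewrite -(ler_pM2l (T0 N N1)).
  have -> : (T N * (c + c' - (a + a')) =
      1 / (2 * tau) * `|A u - z 0%N| ^+ 2 + tau' / 2 * `|v - y 0%N| ^+ 2 -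
      omega ^- N * ((1 - omega * tau / tau') * (1 / (2 * tau)) * `|A u - A (x N)| ^+ 2
        + tau' / 2 * `|v - y N| ^+ 2))%R.
    rewrite /c /c' /a /a' /K last_weightE// -/(T N).
    by field; rewrite !gt_eqF//= ?exprn_gt0// T0.
  by have := gap u v N N1 gu cv; rewrite -/(T N) -/(XN N) -/(YN N); lra.
(* The quadratic terms are nonnegative, so the sign of the Lagrangian gap decides; at the saddle
   point that sign is established in [saddleR]. *)
have lower N : (1 <= N)%N -> forall u v, l u (YN N) <= l (XN N) v -> 0 <= lhs N u v.
  move=> N1 u v luv; have [gX cY] := fins N N1; rewrite /lhs.
  have K0 : (0 <= K N)%R.
    by rewrite /K last_weightE// divr_ge0// ltW// T0.
  rewrite -EFinD adde_ge0//; last exact: lagrangian_gap_ge0.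
  rewrite lee_fin addr_ge0// !mulr_ge0// ?sqr_ge0// ?invr_ge0 ?mulr_ge0// ltW//.
have saddleR N : (1 <= N)%N ->
    (rlagrangian A g h xstar (YN N) <= rlagrangian A g h (XN N) ystar)%R.
  move=> N1; have [gX cY] := fins N N1; rewrite (le_trans (sadd _ cY))//.
  by rewrite (le_trans _ (sadp _ gX))// lerDl mulr_ge0 ?sqr_ge0// divr_ge0// ltW.
have saddle N : (1 <= N)%N -> l xstar (YN N) <= l (XN N) ystar.
  move=> N1; have [gX cY] := fins N N1.
  by rewrite /l !lagrangian_fin// lee_fin saddleR.
pose E0 := (1 / (2 * tau) * `|A xstar - z 0%N| ^+ 2 + tau' / 2 * `|ystar - y 0%N| ^+ 2)%R.
have E00 : (0 <= E0)%R.
  rewrite /E0 addr_ge0// mulr_ge0 ?sqr_ge0// divr_ge0// ?mulr_ge0// ltW//.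
(* At the saddle point all three terms of the gap estimate are nonnegative, so each is bounded by
   the initial energy [E0]. *)
have gapE N : (1 <= N)%N -> [/\
    (T N * (rlagrangian A g h (XN N) ystar - rlagrangian A g h xstar (YN N)) <= E0)%R,
    ((1 - omega * tau / tau') * `|A xstar - A (x N)| ^+ 2 <= 2 * tau * E0 * omega ^+ N)%R &
    (`|ystar - y N| ^+ 2 <= 2 / tau' * E0 * omega ^+ N)%R].
  move=> N1; have := gap xstar ystar N N1 gxs cys.
  rewrite -/(T N) -/(XN N) -/(YN N) -/E0.
  have S0 : (0 <= T N * (rlagrangian A g h (XN N) ystar - rlagrangian A g h xstar (YN N)))%R.
    by rewrite mulr_ge0 ?subr_ge0 ?saddleR// ltW// T0.
  have a0 : (0 <= (1 - omega * tau / tau') * `|A xstar - A (x N)| ^+ 2)%R.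
    by rewrite mulr_ge0// sqr_ge0.
  have b0 : (0 <= `|ystar - y N| ^+ 2)%R by exact: sqr_ge0.
  move: S0; set S := (T N * _)%R => S0.
  rewrite (_ : (1 - omega * tau / tau') * (1 / (2 * tau)) * `|A xstar - A (x N)| ^+ 2 =
     (2 * tau)^-1 * ((1 - omega * tau / tau') * `|A xstar - A (x N)| ^+ 2))%R; last first.
    by rewrite mul1r; ring.
  move: a0 b0; move: (_ * `|A xstar - A (x N)| ^+ 2)%R (`|ystar - y N| ^+ 2)%R.
  move=> a b a0 b0 H.
  have pa : (0 <= (2 * tau)^-1 * a)%R by rewrite mulr_ge0// invr_ge0 mulr_ge0// ltW.
  have pb : (0 <= tau' / 2 * b)%R by rewrite mulr_ge0// divr_ge0// ltW.
  have wa : (0 <= omega ^- N * ((2 * tau)^-1 * a + tau' / 2 * b))%R.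
    by rewrite mulr_ge0 ?addr_ge0// ltW.
  have Q : (omega ^- N * ((2 * tau)^-1 * a + tau' / 2 * b) <= E0)%R by lra.
  split; first lra.
  - move: Q; rewrite ler_pdivrMl ?exprn_gt0// => Q.
    have : ((2 * tau)^-1 * a <= omega ^+ N * E0)%R by lra.
    by rewrite ler_pdivrMl ?mulr_gt0//; lra.
  - move: Q; rewrite ler_pdivrMl ?exprn_gt0// => Q.
    have : (tau' / 2 * b <= omega ^+ N * E0)%R by lra.
    rewrite mulrC -ler_pdivlMr ?divr_gt0// invf_div; lra.
have Tw N : (1 <= N)%N -> ((T N)^-1 <= omega ^+ N / omega)%R.
  case: N => // N _; rewrite exprSr mulfK ?gt_eqF//.
  rewrite -[leRHS]invrK lef_pV2 ?posrE ?T0//; exact: ergodic_weight_ge.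
(* Index 0 is included because the estimate of [z N.+1] involves [y N]. *)
have dual N : (`|ystar - y N| ^+ 2 <= 2 / tau' * E0 * omega ^+ N)%R.
  case: N => [|N]; last by have [] := gapE N.+1 isT.
  rewrite expr0 mulr1 -ler_pdivrMl ?divr_gt0// invf_div /E0 lerDr.
  by rewrite mulr_ge0 ?sqr_ge0// divr_ge0// mulr_ge0// ltW.
split.
- move=> N N1; split.
  + by move=> w1; exact: ergodic_weight_closed.
  + by move=> z0 u v; rewrite -z0; exact: upper.
  + exact: upper.
  + exact: lower.
  + by split; [exact: saddle|apply: lower => //; exact: saddle].
- pose B := (1 + L ^+ 2 / (gamma * delta))%R.
  have B0 : (0 <= B)%R.
    by rewrite addr_ge0// divr_ge0 ?sqr_ge0// mulr_ge0// ltW.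
  (* The first summand serves the objective, with [1 / omega] from the bound [Tw] on [1 / T N]; the
     second serves the dual iterates. *)
  exists (B * E0 / omega + 2 / tau' * E0)%R => N N1.
  have [gX cY] := fins N N1; have [g1 _ _] := gapE N N1.
  have [fX fs fle] := objective_gap gproper gconvex hproper hconvex hlsc gamma_gt0
    gstrong delta_gt0 hstrong xstar_min ystar_grad gX.
  have wN0 : (0 < omega ^+ N)%R by rewrite exprn_gt0.
  have pa : (0 <= B * E0 / omega * omega ^+ N)%R.
    by rewrite !mulr_ge0// ?invr_ge0 ltW.
  have pb : (0 <= 2 / tau' * E0 * omega ^+ N)%R.
    by rewrite !mulr_ge0// ?invr_ge0 ltW.
  split; last by rewrite distrC (le_trans (dual N))// mulrDl; lra.
  apply/andP; split; first by rewrite suber_ge0 //; exact: xstar_min.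
  have -> : f (XN N) - f xstar =
      (fine (objective A g h (XN N)) - fine (objective A g h xstar))%:E.
    by rewrite EFinB !fineK.
  rewrite lee_fin (le_trans fle)// (mulrDl _ _ (omega ^+ N)%R).
  have : (rlagrangian A g h (XN N) ystar - rlagrangian A g h xstar ystar <=
      E0 * (omega ^+ N / omega))%R.
    (* Dual optimality lets the value at [YN N] be replaced by the saddle value, giving the gap
       required by [objective_gap]. *)
    have := sadd _ cY.
    have : (rlagrangian A g h (XN N) ystar - rlagrangian A g h xstar (YN N) <=
        E0 * (omega ^+ N / omega))%R.
      apply: (@le_trans _ _ (E0 * (T N)^-1)%R); last by rewrite ler_wpM2l// Tw.
      by rewrite ler_pdivlMr ?T0// mulrC.
    by rewrite -/(XN N); lra.
  move=> /(ler_wpM2l B0) hB; apply: (le_trans hB).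
  by clearbody B; lra.
- move=> k1; have kp : (0 < 1 - omega * tau / tau')%R by rewrite lt_def k1.
  (* The error of [z N.+1] splits into a primal error and two dual errors, and [norm3_sqr_le] gives
     the factor 3. The last summand carries [1 / omega] because [y N] lags one index behind. *)
  exists (3 * (2 * tau * E0 / (1 - omega * tau / tau') + 2 * tau' * E0
     + 2 * tau' * E0 / omega))%R => -[//|N] _.
  have [_ g2 g3] := gapE N.+1 isT; have g4 := dual N.
  have zE : (z N.+1 - zstar =
      (A (x N.+1) - A xstar) + tau' *: (ystar - y N.+1) - tau' *: (ystar - y N))%R.
    have dE : (tau' *: (y N.+1 - y N) = A (x N.+1) - z N.+1)%R.
      have [_ _ ->] := iter N; rewrite addrAC subrr add0r scalerA mulrC mul1r.
      by rewrite mulVf ?gt_eqF// scale1r.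
    rewrite -addrA -scalerBr (_ : ystar - _ - _ = - (y N.+1 - y N))%R.
      by rewrite scalerN dE opprB addrC addrA subrK.
    by rewrite !opprB addrC subrKA.
  have e1 : (`|A (x N.+1) - A xstar| ^+ 2 <=
      2 * tau * E0 / (1 - omega * tau / tau') * omega ^+ N.+1)%R.
    rewrite distrC -(ler_pM2l kp) (le_trans g2)// le_eqVlt; apply/orP; left.
    by apply/eqP; move: k1; move: (1 - _)%R => k k1; field.
  have e2 : (`|tau' *: (ystar - y N.+1)| ^+ 2 <= 2 * tau' * E0 * omega ^+ N.+1)%R.
    rewrite normrZ exprMn gtr0_norm// -ler_pdivlMl ?exprn_gt0//.
    by rewrite (le_trans g3)// le_eqVlt; apply/orP; left; apply/eqP; field; rewrite gt_eqF.
  have e3 : (`|tau' *: (ystar - y N)| ^+ 2 <= 2 * tau' * E0 / omega * omega ^+ N.+1)%R.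
    rewrite normrZ exprMn gtr0_norm// -ler_pdivlMl ?exprn_gt0//.
    rewrite (le_trans g4)// le_eqVlt; apply/orP; left; apply/eqP; rewrite (exprS omega N); field.
    by rewrite !gt_eqF.
  rewrite zE (le_trans (norm3_sqr_le _ _ _))//; lra.
Qed.
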